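(* Let $\eta\in(1,\infty)$, let $G$ be a subgroup of $\mathbb{R}$ with $\mathbb{Z}\subseteq G$, and let $(q,p)$ be a pair such that each of $q,p$ is $0$ or a prime and either $q=p$, or $q=0$ and $p>0$. Let $\boldsymbol{k}$ be a perfect field of characteristic $p$ with $\operatorname{Card}(\boldsymbol{k})=\aleph_0$. Put $R=\{0\}\cup\{\eta^{-g}\mid g\in G\}$, and define an ultrametric $d$ on the (ordinary or $p$-adic) Hahn field $\mathbb{A}_{q,p}(G,\boldsymbol{k})$ by $d(x,y)=\eta^{-U_{G,\boldsymbol{k},q,p}(x-y)}$ (with $\eta^{-\infty}=0$). Then the following conditions are equivalent: (1) $G$ is order-isomorphic to $\mathbb{Z}$; (2) $(\mathbb{A}_{q,p}(G,\boldsymbol{k}),d)$ is isometric to the $R$-Urysohn universal ultrametric space $(\mathbb{V}_R,\sigma_R)$.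
   Context: **Hahn rings.** For a subgroup $G$ of $\mathbb{R}$ with $\mathbb{Z}\subseteq G$ and a commutative ring $A$, $\mathbb{H}(G,A)$ is the set of maps $a\colon G\to A$ whose support $\operatorname{supp}(a)=\{g\in G\mid a(g)\ne 0\}$ is well-ordered (the empty support being allowed), written $a=\sum_{g\in G}a(g)t^g$, with pointwise addition and convolution product $(ab)(g)=\sum_{i+j=g}a(i)b(j)$. By convention $\min\operatorname{supp}(0)=\infty$. If $A=\boldsymbol{k}$ is a field, $\mathbb{H}(G,\boldsymbol{k})$ is a field with valuation $v_{G,\boldsymbol{k}}(a)=\min\operatorname{supp}(a)$. **$p$-adic Hahn fields.** A field of characteristic $p$ is perfect if $p=0$, or $p>0$ and every element has a $p$-th root. For a perfect field $\boldsymbol{k}$ of characteristic $p>0$, let $\mathbb{W}(\boldsymbol{k})$ be its ring of Witt vectors and $\mathrm{Fr}\mathbb{W}(\boldsymbol{k})$ its fraction field (with the $p$-adic topology). Let $\mathbb{N}_{G,\boldsymbol{k}}$ be the set of all $\alpha=\sum_g\alpha_gt^g\in\mathbb{H}(G,\mathbb{W}(\boldsymbol{k}))$ such that $\sum_{n\in\mathbb{Z}}\alpha_{g+n}p^n=0$ in $\mathrm{Fr}\mathbb{W}(\boldsymbol{k})$ for every $g\in G$; it is a maximal ideal. Put $\mathbb{P}_p(G,\boldsymbol{k})=\mathbb{H}(G,\mathbb{W}(\boldsymbol{k}))/\mathbb{N}_{G,\boldsymbol{k}}$ with canonical projection $\mathrm{Pr}$. A complete system of representatives is a subset $J\subseteq\mathbb{W}(\boldsymbol{k})$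 with $0\in J$ that the residue map sends bijectively to $\boldsymbol{k}$. Every $a\in\mathbb{H}(G,\mathbb{W}(\boldsymbol{k}))$ is congruent modulo $\mathbb{N}_{G,\boldsymbol{k}}$ to a unique series $\mathrm{St}_{G,\boldsymbol{k},J}(a)$ with all coefficients in $J$. The valuation on $\mathbb{P}_p(G,\boldsymbol{k})$ is $V_{G,\boldsymbol{k},p}(\mathrm{Pr}(a))=\min\operatorname{supp}(\mathrm{St}_{G,\boldsymbol{k},J}(a))$, which is independent of $J$. Put $(\mathbb{A}_{q,p}(G,\boldsymbol{k}),U_{G,\boldsymbol{k},q,p})=(\mathbb{H}(G,\boldsymbol{k}),v_{G,\boldsymbol{k}})$ if $q=p$ and $(\mathbb{P}_p(G,\boldsymbol{k}),V_{G,\boldsymbol{k},p})$ if $q\neq p$. **Urysohn universal ultrametric spaces.** Metric spaces are nonempty. A range set is a subset $R\subseteq[0,\infty)$ with $0\in R$; a metric space is $R$-valued if all its distances lie in $R$. Let $\mathscr{N}(R)$ be the class of finite $R$-valued ultrametric spaces. A metric space $X$ is $\mathscr{N}(R)$-injective if for all $A,B\in\mathscr{N}(R)$ and isometric embeddings $\phi\colon A\to B$, $\psi\colon A\to X$ there is an isometric embedding $\theta\colon B\to X$ with $\theta\circ\phi=\psi$. If $R$ is countable, $(\mathbb{V}_R,\sigma_R)$ denotes the separable complete $R$-valued $\mathscr{N}(R)$-injective ultrametric space, which is unique up to isometry. If $R$ is uncountable, $(\mathbb{V}_R,\sigma_R)$ denotes the $R$-petaloid ultrametric space (unique up to isometry),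 defined as follows. A subset of $[0,\infty)$ is tenuous if it is finite or of the form $\{0\}\cup\{a_i\mid i\in\mathbb{Z}_{\ge0}\}$ with $(a_i)$ strictly decreasing in $(0,\infty)$ and $a_i\to0$. Let $\mathbf{TEN}(R)$ be the set of tenuous subsets of $R$ containing $0$. An $R$-valued ultrametric space $(X,d)$ is $R$-petaloid if there is a family $\{\Pi(X,S)\}_{S\in\mathbf{TEN}(R)}$ of subspaces of $X$ such that: (P1) each $(\Pi(X,S),d)$ is isometric to $(\mathbb{V}_S,\sigma_S)$ ($S$ being countable); (P2) $\bigcup_S\Pi(X,S)=X$; (P3) $\Pi(X,S)\cap\Pi(X,T)=\Pi(X,S\cap T)$ for all $S,T$; (P4) for $S,T\in\mathbf{TEN}(R)$ and $x\in\Pi(X,T)$, $d(x,\Pi(X,S))=\inf\{d(x,a)\mid a\in\Pi(X,S)\}$ belongs to $(T\setminus S)\cup\{0\}$. *)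

(* Defs.v *)
From HB Require Import structures.
From mathcomp Require Import all_boot all_order all_algebra finmap.
From mathcomp.multinomials Require Import monalg.
From mathcomp Require Import all_classical all_reals all_analysis.

Set Implicit Arguments.
Unset Strict Implicit.
Unset Printing Implicit Defensive.

Import Order.TTheory GRing.Theory Num.Theory.

Local Open Scope classical_set_scope.
Local Open Scope ring_scope.

(* The polynomial ring Z[X_(j, i) : j, i in nat]; for fixed j, the variables
   X_(j, 0), X_(j, 1), ... are the components of the j-th generic vector. *)
Definition wpoly : comNzRingType := {malg int[{cmonom (nat * nat)%type}]}.

Definition wvar (j i : nat) : wpoly := << ucm (j, i) >>.

Section Evaluation.
Variables (B : comNzRingType) (f : nat * nat -> B).

Definition mon_eval (m : {cmonom (nat * nat)%type}) : B :=
  \prod_(v <- finsupp m) f v ^+ m v.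

Lemma mon_evalEw (d : {fset (nat * nat)%type}) (m : {cmonom (nat * nat)%type}) :
  fsubset (finsupp m) d -> mon_eval m = \prod_(v <- d) f v ^+ m v.
Proof.
move=> le; rewrite /mon_eval; apply/esym.
rewrite (big_fsetID _ (mem (finsupp m))) /=.
rewrite [X in _ * X = _]big1_fset ?mulr1; last first.
  move=> i; rewrite !inE /= => /andP[_]; rewrite memNfinsupp => /eqP -> _.
  by rewrite expr0.
apply: eq_fbigl => i; rewrite !inE /= andbC andb_idr // => im.
by move/fsubsetP: le; apply.
Qed.

Lemma mon_eval_mmorphism : mmorphism mon_eval.
Proof.
split=> [m1 m2|].
  rewrite (@mon_evalEw (finsupp m1 `|` finsupp m2)%fset m1) ?fsubsetUl //.
  rewrite (@mon_evalEw (finsupp m1 `|` finsupp m2)%fset m2) ?fsubsetUr //.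
  rewrite (@mon_evalEw (finsupp m1 `|` finsupp m2)%fset) ?mdomD //.
  by rewrite -big_split /=; apply: eq_bigr => i _; rewrite cmM exprD.
by rewrite /mon_eval mdom1 big_seq_fset0.
Qed.
HB.instance Definition _ :=
  isMultiplicative.Build {cmonom (nat * nat)%type} B mon_eval mon_eval_mmorphism.

Definition weval : wpoly -> B := mmap intr mon_eval.
HB.instance Definition _ := GRing.RMorphism.on weval.

Lemma weval_var j i : weval (wvar j i) = f (j, i).
Proof.
rewrite /weval /wvar mmapU mul1r /mon_eval mdomU big_seq_fset1.
by rewrite ucmE eqxx expr1.
Qed.
End Evaluation.

Lemma malgUM (k1 k2 : {cmonom (nat * nat)%type}) :
  << mmul k1 k2 >> = << k1 >> * << k2 >> :> wpoly.
Proof. by apply/esym; rewrite [LHS]malgM_def fgmulUU mulr1. Qed.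

Lemma wpoly_ind (P : wpoly -> Prop) :
  P 1 -> (forall x y, P x -> P y -> P (x - y)) ->
  (forall x y, P x -> P y -> P (x * y)) -> (forall j i, P (wvar j i)) ->
  forall x, P x.
Proof.
move=> P1 PB PM PX.
have P0 : P 0 by rewrite -(subrr 1); apply: PB.
have PN x : P x -> P (- x) by move=> Px; rewrite -sub0r; apply: PB.
have PD x y : P x -> P y -> P (x + y).
  by move=> Px Py; rewrite -[y]opprK; apply: PB => //; apply: PN.
have Pn (n : nat) : P n%:R.
  by elim: n => // n IH; rewrite -addn1 natrD; apply: PD.
have Pz (z : int) : P z%:~R.
  by case: z => n; [apply: Pn | rewrite NegzE mulrNz; apply/PN/Pn].
have Pm (k : {cmonom (nat * nat)%type}) : P << k >>.
  have [n] := ubnP (mdeg k); elim: n k => [k k0|n IH k kn].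
    by exfalso; move: k0; rewrite ltn0.
  have [/eqP k0|k0] := boolP (mdeg k == 0%N).
    by rewrite (mdeg_eq0I k0).
  have [v vk] : exists v, v \in finsupp k.
    apply/fset0Pn; apply: contra k0 => /eqP k0.
    by rewrite mdegE k0 big_seq_fset0.
  have kE : k = mmul (ucm v) (divcm k (ucm v)).
    apply/eqP/cmP => w; rewrite cmM divcmE subnKC // ucmE.
    by case: eqP => [<-|//]; rewrite lt0n cmE_neq0.
  rewrite kE malgUM.
  apply: PM; first by case: v {vk kE} => j i; apply: PX.
  apply: IH; move: kn; rewrite {1}kE mdegM mdegU.
  by rewrite add1n ltnS => ->.
move=> x; have -> : x = \sum_(k <- msupp x) (<< k >> : wpoly) *~ x@_k.
  rewrite [LHS]monalgE; apply: eq_bigr => k _.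
  by rewrite -[LHS]/(mkmalgU k _) -[x@_k in LHS]intz raddfMz.
apply: (big_ind P); [exact: P0|exact: PD|move=> k _].
rewrite -mulrzl; apply: PM; [exact: Pz|exact: Pm].
Qed.

Lemma wpoly_mulrIn n (x y : wpoly) : (0 < n)%N -> x *+ n = y *+ n -> x = y.
Proof.
move=> n0 xy; apply/malgP => k; move/malgP: xy => /(_ k).
by rewrite !mcoeffMn => /(pmulrnI n0).
Qed.

Section Congruence.
Variable B : comNzRingType.
Implicit Types (x y z t : B) (n m e : nat).

Definition cong n x y := exists z, x = y + z *+ n.

Lemma cong_refl n x : cong n x x.
Proof. by exists 0; rewrite mul0rn addr0. Qed.

Lemma cong_sym n x y : cong n x y -> cong n y x.
Proof. by move=> [z ->]; exists (- z); rewrite mulNrn addrK. Qed.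

Lemma cong_trans n y x z : cong n x y -> cong n y z -> cong n x z.
Proof. by move=> [a ->] [b ->]; exists (b + a); rewrite mulrnDl addrA. Qed.

Lemma congD n x y z t : cong n x y -> cong n z t -> cong n (x + z) (y + t).
Proof. by move=> [a ->] [b ->]; exists (a + b); rewrite mulrnDl addrACA. Qed.

Lemma congN n x y : cong n x y -> cong n (- x) (- y).
Proof. by move=> [a ->]; exists (- a); rewrite mulNrn opprD. Qed.

Lemma congB n x y z t : cong n x y -> cong n z t -> cong n (x - z) (y - t).
Proof. by move=> h1 h2; apply: congD => //; apply: congN. Qed.

Lemma congM n x y z t : cong n x y -> cong n z t -> cong n (x * z) (y * t).
Proof.
move=> [a ->] [b ->]; exists (a * (t + b *+ n) + y * b).
by rewrite mulrDl mulrDr mulrnDl mulrnAl mulrnAr addrAC -addrA [X in _ + X]addrC.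
Qed.

Lemma congX n x y e : cong n x y -> cong n (x ^+ e) (y ^+ e).
Proof.
move=> xy; elim: e => [|e IH]; first by rewrite !expr0; apply: cong_refl.
by rewrite !exprS; apply: congM.
Qed.

Lemma cong_sum n r (F1 F2 : 'I_r -> B) :
  (forall i, cong n (F1 i) (F2 i)) -> cong n (\sum_i F1 i) (\sum_i F2 i).
Proof.
move=> h; elim/big_ind2 : _ => //; first exact: cong_refl.
by move=> *; apply: congD.
Qed.

Lemma cong_mulrn n m x y : cong n x y -> cong (m * n) (x *+ m) (y *+ m).
Proof. by move=> [z ->]; exists z; rewrite mulrnDl -mulrnA mulnC. Qed.

Lemma cong_dvd m n x y : (m %| n)%N -> cong n x y -> cong m x y.
Proof.
by move=> /dvdnP[d ->] [z ->]; exists (z *+ d); rewrite -mulrnA.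
Qed.

Lemma cong0 n x : cong n (x *+ n) 0.
Proof. by exists x; rewrite add0r. Qed.

Lemma cong_expp (p e : nat) x y :
  cong (p ^ e.+1) x y -> cong (p ^ e.+2) (x ^+ p) (y ^+ p).
Proof.
move=> h.
have hp : cong p x y.
  by apply: cong_dvd h; rewrite expnS dvdn_mulr.
case: h => z xE.
have [w wE] : cong p (\sum_(i < p) x ^+ (p.-1 - i) * y ^+ i) 0.
  apply: (@cong_trans _ (\sum_(i < p) x ^+ p.-1)).
    apply: cong_sum => i.
    have {2}-> : p.-1 = (p.-1 - i + i)%N.
      by rewrite subnK //; case: (p) i => [[]|q i] //; rewrite -ltnS.
    rewrite exprD; apply: congM; first exact: cong_refl.
    by apply: congX; apply: cong_sym.
  by rewrite sumr_const card_ord; apply: cong0.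
exists (z * w); rewrite -[LHS](subrK (y ^+ p)) addrC subrXX wE add0r; congr (_ + _).
by rewrite {1}xE addrC addKr mulrnAl mulrnAr -mulrnA -expnS.
Qed.

Lemma cong_exp (p e : nat) x y :
  cong p x y -> cong (p ^ e.+1) (x ^+ (p ^ e)) (y ^+ (p ^ e)).
Proof.
move=> h; elim: e => [|e IH]; first by rewrite expn1 expn0 !expr1.
by rewrite [(p ^ e.+1)%N]expnSr !exprM; apply: cong_expp.
Qed.

Lemma cong_FrobD (p : nat) x y :
  prime p -> cong p ((x + y) ^+ p) (x ^+ p + y ^+ p).
Proof.
case: p => // p pp; rewrite exprDn big_ord_recl big_ord_recr /= subn0 expr0 mulr1.
rewrite subnn expr0 mul1r bin0 binn !mulr1n.
rewrite addrCA -[X in cong _ _ X]add0r; apply: congD; last exact: cong_refl.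
apply: (big_ind (fun z => cong p.+1 z 0)); first exact: cong_refl.
  by move=> a b ha hb; rewrite -[0]addr0; apply: congD.
move=> i _; have /dvdnP[d ->] : (p.+1 %| 'C(p.+1, bump 0 i))%N.
  by apply: prime_dvd_bin => //; rewrite /bump /= add1n ltnS ltn_ord.
by rewrite mulrnA; apply: cong0.
Qed.

End Congruence.

Section Ghost.
Variables (p : nat) (B : comNzRingType).

(* The n-th ghost component (Witt polynomial) of a. *)
Definition ghost (n : nat) (a : nat -> B) : B :=
  \sum_(i < n.+1) (a i ^+ (p ^ (n - i))) *+ p ^ i.

Lemma ghost_recr n a :
  ghost n a = \sum_(i < n) (a i ^+ (p ^ (n - i))) *+ p ^ i + a n *+ p ^ n.
Proof. by rewrite /ghost big_ord_recr /= subnn expn0 expr1. Qed.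

Lemma ghost0 a : ghost 0 a = a 0%N.
Proof. by rewrite ghost_recr big_ord0 add0r expn0. Qed.

End Ghost.

Lemma ghost_morph p (B C : comNzRingType) (h : {rmorphism B -> C}) n a :
  ghost p n (h \o a) = h (ghost p n a).
Proof.
by rewrite /ghost rmorph_sum; apply: eq_bigr => i _; rewrite rmorphMn rmorphXn.
Qed.

Section FrobeniusLift.
Variables (p : nat) (P : comNzRingType) (phi : {rmorphism P -> P}).
Hypothesis p_gt0 : (0 < p)%N.
Hypothesis P_mulrIn : forall n (x y : P), (0 < n)%N -> x *+ n = y *+ n -> x = y.
Hypothesis phi_cong : forall x, cong p (phi x) (x ^+ p).

Lemma phi_ghost n a : cong (p ^ n.+1) (phi (ghost p n a)) (ghost p n.+1 a).
Proof.
rewrite [ghost _ n.+1 _]ghost_recr -[phi _]addr0; apply: congD; last first.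
  exact/cong_sym/cong0.
rewrite /ghost rmorph_sum; apply: cong_sum => i; rewrite rmorphMn rmorphXn.
have ile : (i <= n)%N by rewrite -ltnS.
have -> : (p ^ n.+1 = p ^ i * p ^ (n - i).+1)%N by rewrite -expnD addnS subnKC.
apply: cong_mulrn; rewrite (subSn ile).
have -> : a i ^+ (p ^ (n - i).+1) = (a i ^+ p) ^+ (p ^ (n - i)).
  by rewrite expnS exprM.
exact: (cong_exp _ (phi_cong _)).
Qed.

Lemma ghost_exists (u : nat -> P) :
  (forall n, cong (p ^ n.+1) (phi (u n)) (u n.+1)) ->
  exists S, forall n, ghost p n S = u n.
Proof.
move=> hu.
pose part (s : seq P) := \sum_(i < size s) (s`_i ^+ (p ^ (size s - i))) *+ p ^ i.
pose step (s : seq P) t := xget 0 [set z | t = part s + z *+ p ^ size s].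
pose fix sq n := if n is m.+1 then rcons (sq m) (step (sq m) (u m)) else [::].
have szs n : size (sq n) = n by elim: n => //= n IH; rewrite size_rcons IH.
pose S n := (sq n.+1)`_n.
have SE n i : (i < n)%N -> (sq n)`_i = S i.
  elim: n => // n IH; rewrite ltnS leq_eqVlt => /predU1P[-> //|lt_in].
  by rewrite /= nth_rcons szs lt_in IH.
have partE n : part (sq n) = \sum_(i < n) (S i ^+ (p ^ (n - i))) *+ p ^ i.
  by rewrite /part szs; apply: eq_bigr => i _; rewrite SE.
have SP n z : u n = part (sq n) + z *+ p ^ n -> u n = part (sq n) + S n *+ p ^ n.
  move=> uE; rewrite /S /= nth_rcons szs ltnn eqxx /step szs.
  by case: xgetP => [w _ -> //|/(_ z uE)].
exists S => n; elim: n => [|n IH]; rewrite ghost_recr -partE; apply/esym.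
  by apply: (SP _ (u 0%N)); rewrite partE big_ord0 add0r expn0 mulr1n.
have h1 := cong_sym (hu n); rewrite -IH in h1.
have [z hz] := cong_trans h1 (phi_ghost n S).
rewrite ghost_recr -partE -addrA -mulrnDl in hz.
exact: (SP _ _ hz).
Qed.

Lemma ghost_cong (a b : nat -> P) :
  (forall n, cong (p ^ n.+1) (ghost p n a) (ghost p n b)) ->
  forall n, cong p (a n) (b n).
Proof.
move=> h n; have [m] := ubnP n; elim: m n => // m IH n; rewrite ltnS => nm.
have := h n; rewrite !ghost_recr => h1.
have h2 : cong (p ^ n.+1) (\sum_(i < n) (a i ^+ (p ^ (n - i))) *+ p ^ i)
                          (\sum_(i < n) (b i ^+ (p ^ (n - i))) *+ p ^ i).
  apply: cong_sum => i.
  have -> : (p ^ n.+1 = p ^ i * p ^ (n - i).+1)%N.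
    by rewrite -expnD addnS subnKC // ltnW.
  by apply/cong_mulrn/cong_exp/IH/(leq_trans (ltn_ord i)).
have [z] := congB h1 h2; rewrite !(addrAC _ _ (- _)) !subrr !add0r => zE.
exists z; apply: (@P_mulrIn (p ^ n)); first by rewrite expn_gt0 p_gt0.
by rewrite zE mulrnDl -mulrnA -expnS.
Qed.

Lemma ghost_inj (a b : nat -> P) :
  (forall n, ghost p n a = ghost p n b) -> a = b.
Proof.
move=> h; apply/funext => n; have [m] := ubnP n; elim: m n => // m IH n.
rewrite ltnS => nm; have := h n; rewrite !ghost_recr.
under eq_bigr => i _ do rewrite IH ?(leq_trans (ltn_ord i)) //.
by move/addrI/P_mulrIn; apply; rewrite expn_gt0 p_gt0.
Qed.

End FrobeniusLift.

Section WittPolynomials.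
Variable p : nat.
Hypothesis pp : prime p.

Definition wphi : wpoly -> wpoly := weval (fun v => wvar v.1 v.2 ^+ p).
HB.instance Definition _ := GRing.RMorphism.on wphi.

Lemma wphi_cong x : cong p (wphi x) (x ^+ p).
Proof.
elim/wpoly_ind: x => [|x y hx hy|x y hx hy|j i].
- by rewrite rmorph1 expr1n; apply: cong_refl.
- rewrite rmorphB; apply: (cong_trans (congB hx hy)).
  have h := cong_FrobD (x - y) y pp; rewrite subrK in h.
  have h2 := congB h (cong_refl p (y ^+ p)).
  by rewrite addrK in h2.
- by rewrite rmorphM exprMn; apply: (congM hx hy).
- by rewrite /wphi weval_var; apply: cong_refl.
Qed.
End WittPolynomials.

Section WittOperations.
Variables (p : nat).

(* The unique sequence of polynomials with prescribed ghost components. *)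
Definition of_ghost (u : nat -> wpoly) : nat -> wpoly :=
  xget (fun=> 0) [set S | forall n, ghost p n S = u n].

(* S_n, P_n and N_n: the structure polynomials of the sum, product and opposite
   of Witt vectors. *)
Definition wadd_poly : nat -> wpoly :=
  of_ghost (fun n => ghost p n (wvar 0) + ghost p n (wvar 1)).
Definition wmul_poly : nat -> wpoly :=
  of_ghost (fun n => ghost p n (wvar 0) * ghost p n (wvar 1)).
Definition wopp_poly : nat -> wpoly := of_ghost (fun n => - ghost p n (wvar 0)).

Definition wsubst (B : comNzRingType) (s : seq (nat -> B)) (v : nat * nat) : B :=
  nth (fun=> 0) s v.1 v.2.

Variable B : comNzRingType.
Implicit Types a b c : nat -> B.

Definition wadd a b n := weval (wsubst [:: a; b]) (wadd_poly n).
Definition wmul a b n := weval (wsubst [:: a; b]) (wmul_poly n).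
Definition wopp a n := weval (wsubst [:: a]) (wopp_poly n).
Definition wzero : nat -> B := fun=> 0.
Definition wone : nat -> B := fun n => (n == 0%N)%:R.
End WittOperations.

Lemma weval_uniq (B : comNzRingType) (g : {rmorphism wpoly -> B}) x :
  g x = weval (fun v => g (wvar v.1 v.2)) x.
Proof.
elim/wpoly_ind: x => [|x y hx hy|x y hx hy|j i].
- exact: (etrans (rmorph1 g) (esym (rmorph1 _))).
- by rewrite (rmorphB g) [RHS]rmorphB hx hy.
- by rewrite (rmorphM g) [RHS]rmorphM hx hy.
- by rewrite weval_var.
Qed.

Lemma weval_comp (B C : comNzRingType) (h : {rmorphism B -> C}) f x :
  h (weval f x) = weval (h \o f) x.
Proof.
rewrite -[LHS]/((h \o weval f) x) weval_uniq; congr (weval _ x).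
by apply/funext => -[j i]; rewrite /= weval_var.
Qed.

Lemma weval_wsubst (B : comNzRingType) (s : seq (nat -> B)) j :
  weval (wsubst s) \o wvar j = nth (fun=> 0) s j.
Proof. by apply/funext => i; rewrite /= weval_var. Qed.

Lemma weval_ghost (B : comNzRingType) (s : seq (nat -> B)) p n j :
  weval (wsubst s) (ghost p n (wvar j)) = ghost p n (nth (fun=> 0) s j).
Proof. exact: etrans (esym (ghost_morph p _ n _)) (congr1 _ (weval_wsubst s j)). Qed.

Section WittNaturality.
Variables (p : nat) (B C : comNzRingType) (h : {rmorphism B -> C}).
Implicit Types a b : nat -> B.

Lemma wsubst_morph (s : seq (nat -> B)) :
  h \o wsubst s = wsubst [seq h \o a | a <- s].
Proof.
apply/funext => -[j i]; rewrite /wsubst /=; have [js|js] := ltnP j (size s).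
  by rewrite (nth_map (fun=> 0)).
by rewrite !nth_default ?size_map //= rmorph0.
Qed.

Lemma wadd_morph a b : h \o wadd p a b = wadd p (h \o a) (h \o b).
Proof.
by apply/funext => n; rewrite /wadd -[LHS]/(h _) weval_comp wsubst_morph.
Qed.

Lemma wmul_morph a b : h \o wmul p a b = wmul p (h \o a) (h \o b).
Proof.
by apply/funext => n; rewrite /wmul -[LHS]/(h _) weval_comp wsubst_morph.
Qed.

Lemma wopp_morph a : h \o wopp p a = wopp p (h \o a).
Proof.
by apply/funext => n; rewrite /wopp -[LHS]/(h _) weval_comp wsubst_morph.
Qed.

Lemma wzero_morph : h \o @wzero B = @wzero C.
Proof. by apply/funext => n; rewrite -[LHS]/(h 0) rmorph0. Qed.

Lemma wone_morph : h \o @wone B = @wone C.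
Proof. by apply/funext => n; rewrite -[LHS]/(h _%:R) rmorph_nat. Qed.
End WittNaturality.

Section WittTheory.
Variable p : nat.
Hypothesis pp : prime p.
Let p_gt0 : (0 < p)%N := prime_gt0 pp.

Lemma of_ghostP (u : nat -> wpoly) :
  (forall n, cong (p ^ n.+1) (wphi p (u n)) (u n.+1)) ->
  forall n, ghost p n (of_ghost p u) = u n.
Proof.
move=> hu.
have [S hS] := @ghost_exists p wpoly (wphi p) (wphi_cong pp) u hu.
rewrite /of_ghost; case: xgetP => [T _ hT|/(_ S)]; first exact: hT.
by move=> hN; case: (hN hS).
Qed.

Let cong_gX j n :
  cong (p ^ n.+1) (wphi p (ghost p n (wvar j))) (ghost p n.+1 (wvar j)).
Proof. exact: (@phi_ghost p wpoly (wphi p) (wphi_cong pp)). Qed.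

Section GhostOps.
Variable B : comNzRingType.
Implicit Types a b c : nat -> B.

Lemma ghost_wadd n a b : ghost p n (wadd p a b) = ghost p n a + ghost p n b.
Proof.
have -> : wadd p a b = weval (wsubst [:: a; b]) \o wadd_poly p by [].
rewrite ghost_morph of_ghostP; last first.
  by move=> m; rewrite rmorphD; apply: (congD (cong_gX _ _) (cong_gX _ _)).
rewrite (rmorphD (weval _)); congr (_ + _); exact: weval_ghost.
Qed.

Lemma ghost_wmul n a b : ghost p n (wmul p a b) = ghost p n a * ghost p n b.
Proof.
have -> : wmul p a b = weval (wsubst [:: a; b]) \o wmul_poly p by [].
rewrite ghost_morph of_ghostP; last first.
  by move=> m; rewrite rmorphM; apply: (congM (cong_gX _ _) (cong_gX _ _)).
rewrite (rmorphM (weval _)); congr (_ * _); exact: weval_ghost.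
Qed.

Lemma ghost_wopp n a : ghost p n (wopp p a) = - ghost p n a.
Proof.
have -> : wopp p a = weval (wsubst [:: a]) \o wopp_poly p by [].
rewrite ghost_morph of_ghostP; last first.
  by move=> m; rewrite rmorphN; apply: (congN (cong_gX _ _)).
rewrite (rmorphN (weval _)); congr (- _); exact: weval_ghost.
Qed.

Lemma ghost_wzero n : ghost p n (@wzero B) = 0.
Proof.
rewrite /ghost big1 // => i _.
by rewrite expr0n eqn0Ngt expn_gt0 p_gt0 mul0rn.
Qed.

Lemma ghost_wone n : ghost p n (@wone B) = 1.
Proof.
rewrite /ghost big_ord_recl subn0 expr1n expn0 mulr1n big1 ?addr0 // => i _.
by rewrite expr0n eqn0Ngt expn_gt0 p_gt0 mul0rn.
Qed.
End GhostOps.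

Section TorsionFree.
Variables (P : comNzRingType) (x y z : nat -> P).
Hypothesis P_mulrIn : forall n (x y : P), (0 < n)%N -> x *+ n = y *+ n -> x = y.
Let inj := ghost_inj p_gt0 P_mulrIn.

Lemma waddA_tf : wadd p x (wadd p y z) = wadd p (wadd p x y) z.
Proof. by apply: inj => n; rewrite !ghost_wadd addrA. Qed.
Lemma waddC_tf : wadd p x y = wadd p y x.
Proof. by apply: inj => n; rewrite !ghost_wadd addrC. Qed.
Lemma wadd0_tf : wadd p (@wzero P) x = x.
Proof. by apply: inj => n; rewrite ghost_wadd ghost_wzero add0r. Qed.
Lemma waddN_tf : wadd p (wopp p x) x = @wzero P.
Proof. by apply: inj => n; rewrite ghost_wadd ghost_wzero ghost_wopp addNr. Qed.
Lemma wmulA_tf : wmul p x (wmul p y z) = wmul p (wmul p x y) z.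
Proof. by apply: inj => n; rewrite !ghost_wmul mulrA. Qed.
Lemma wmulC_tf : wmul p x y = wmul p y x.
Proof. by apply: inj => n; rewrite !ghost_wmul mulrC. Qed.
Lemma wmul1_tf : wmul p (@wone P) x = x.
Proof. by apply: inj => n; rewrite ghost_wmul ghost_wone mul1r. Qed.
Lemma wmulDl_tf : wmul p (wadd p x y) z = wadd p (wmul p x z) (wmul p y z).
Proof. by apply: inj => n; rewrite !(ghost_wmul, ghost_wadd) mulrDl. Qed.
End TorsionFree.

Section RingLaws.
Variable B : comNzRingType.
Implicit Types a b c : nat -> B.

Lemma generic3 a b c : exists h : {rmorphism wpoly -> B}, exists x y z,
  [/\ a = h \o x, b = h \o y & c = h \o z].
Proof.
exists (weval (wsubst [:: a; b; c])), (wvar 0), (wvar 1), (wvar 2).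
by split; apply/esym; exact: weval_wsubst.
Qed.

Section Transport.
Variable h : {rmorphism wpoly -> B}.
Let addE a b x y : a = h \o x -> b = h \o y -> wadd p a b = h \o wadd p x y.
Proof. by move=> -> ->; rewrite wadd_morph. Qed.
Let mulE a b x y : a = h \o x -> b = h \o y -> wmul p a b = h \o wmul p x y.
Proof. by move=> -> ->; rewrite wmul_morph. Qed.
Let oppE a x : a = h \o x -> wopp p a = h \o wopp p x.
Proof. by move=> ->; rewrite wopp_morph. Qed.
Let glue a b x y : a = h \o x -> b = h \o y -> x = y -> a = b.
Proof. by move=> -> -> ->. Qed.
Variables (a b c : nat -> B) (x y z : nat -> wpoly).
Hypotheses (ax : a = h \o x) (bY : b = h \o y) (cz : c = h \o z).
Let e0 := esym (wzero_morph h).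
Let e1 := esym (wone_morph h).

Lemma waddA_tr : wadd p a (wadd p b c) = wadd p (wadd p a b) c.
Proof. exact: glue (addE ax (addE bY cz)) (addE (addE ax bY) cz) (waddA_tf _ _ _ wpoly_mulrIn). Qed.
Lemma waddC_tr : wadd p a b = wadd p b a.
Proof. exact: glue (addE ax bY) (addE bY ax) (waddC_tf _ _ wpoly_mulrIn). Qed.
Lemma wadd0_tr : wadd p (@wzero B) a = a.
Proof. exact: glue (addE e0 ax) ax (wadd0_tf _ wpoly_mulrIn). Qed.
Lemma waddN_tr : wadd p (wopp p a) a = @wzero B.
Proof. exact: glue (addE (oppE ax) ax) e0 (waddN_tf _ wpoly_mulrIn). Qed.
Lemma wmulA_tr : wmul p a (wmul p b c) = wmul p (wmul p a b) c.
Proof. exact: glue (mulE ax (mulE bY cz)) (mulE (mulE ax bY) cz) (wmulA_tf _ _ _ wpoly_mulrIn). Qed.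
Lemma wmulC_tr : wmul p a b = wmul p b a.
Proof. exact: glue (mulE ax bY) (mulE bY ax) (wmulC_tf _ _ wpoly_mulrIn). Qed.
Lemma wmul1_tr : wmul p (@wone B) a = a.
Proof. exact: glue (mulE e1 ax) ax (wmul1_tf _ wpoly_mulrIn). Qed.
Lemma wmulDl_tr : wmul p (wadd p a b) c = wadd p (wmul p a c) (wmul p b c).
Proof.
exact: glue (mulE (addE ax bY) cz) (addE (mulE ax cz) (mulE bY cz))
            (wmulDl_tf _ _ _ wpoly_mulrIn).
Qed.
End Transport.

Lemma waddA a b c : wadd p a (wadd p b c) = wadd p (wadd p a b) c.
Proof.
have [h [x [y [z [ha hb hc]]]]] := generic3 a b c; exact: (waddA_tr ha hb hc).
Qed.
Lemma waddC a b : wadd p a b = wadd p b a.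
Proof.
have [h [x [y [z [ha hb hc]]]]] := generic3 a b a; exact: (waddC_tr ha hb).
Qed.
Lemma wadd0 a : wadd p (@wzero B) a = a.
Proof.
have [h [x [y [z [ha hb hc]]]]] := generic3 a a a; exact: (wadd0_tr ha).
Qed.
Lemma waddN a : wadd p (wopp p a) a = @wzero B.
Proof.
have [h [x [y [z [ha hb hc]]]]] := generic3 a a a; exact: (waddN_tr ha).
Qed.
Lemma wmulA a b c : wmul p a (wmul p b c) = wmul p (wmul p a b) c.
Proof.
have [h [x [y [z [ha hb hc]]]]] := generic3 a b c; exact: (wmulA_tr ha hb hc).
Qed.
Lemma wmulC a b : wmul p a b = wmul p b a.
Proof.
have [h [x [y [z [ha hb hc]]]]] := generic3 a b a; exact: (wmulC_tr ha hb).
Qed.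
Lemma wmul1 a : wmul p (@wone B) a = a.
Proof.
have [h [x [y [z [ha hb hc]]]]] := generic3 a a a; exact: (wmul1_tr ha).
Qed.
Lemma wmulDl a b c : wmul p (wadd p a b) c = wadd p (wmul p a c) (wmul p b c).
Proof.
have [h [x [y [z [ha hb hc]]]]] := generic3 a b c; exact: (wmulDl_tr ha hb hc).
Qed.

Lemma wadd_0 a b : wadd p a b 0%N = a 0%N + b 0%N.
Proof. by have := ghost_wadd 0 a b; rewrite !ghost0. Qed.

Lemma wmul_0 a b : wmul p a b 0%N = a 0%N * b 0%N.
Proof. by have := ghost_wmul 0 a b; rewrite !ghost0. Qed.

Definition wshift a : nat -> B := fun n => if n is m.+1 then a m else 0.
End RingLaws.

Lemma wshift_morph (B C : comNzRingType) (h : {rmorphism B -> C}) a :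
  h \o wshift a = wshift (h \o a).
Proof. by apply/funext => -[|n] //=; rewrite rmorph0. Qed.

Lemma ghost_wshift0 (B : comNzRingType) (a : nat -> B) : ghost p 0 (wshift a) = 0.
Proof. by rewrite ghost0. Qed.

Lemma ghost_wshiftS (B : comNzRingType) (a : nat -> B) n :
  ghost p n.+1 (wshift a) = ghost p n a *+ p.
Proof.
rewrite /ghost big_ord_recl expr0n subn0 eqn0Ngt expn_gt0 p_gt0 mul0rn add0r.
rewrite -sumrMnl; apply: eq_bigr => i _.
by rewrite -mulrnA -expnSr.
Qed.

Lemma ghost_frob (B : comNzRingType) (a : nat -> B) n :
  ghost p n.+1 a = ghost p n (fun i => a i ^+ p) + a n.+1 *+ p ^ n.+1.
Proof.
rewrite ghost_recr; congr (_ + _); apply: eq_bigr => i _.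
have ile : (i <= n)%N by rewrite -ltnS.
by rewrite (subSn ile) expnS exprM.
Qed.

Section CharP.
Variables (B : comNzRingType) (pB : p \in [pchar B]).
Implicit Types a b : nat -> B.

Definition wfrob a : nat -> B := fun i => a i ^+ p.

Lemma wfrob_mul a b : wfrob (wmul p a b) = wmul p (wfrob a) (wfrob b).
Proof. exact: (wmul_morph p (pFrobenius_aut pB)). Qed.

Lemma cong_pchar (h : {rmorphism wpoly -> B}) x y : cong p x y -> h x = h y.
Proof.
move=> [z ->]; rewrite (rmorphD h) (rmorphMn h) -mulr_natr pcharf0 //.
by rewrite mulr0 addr0.
Qed.

Lemma wshift_mul_cong (P : comNzRingType) (x y : nat -> P) n :
  cong (p ^ n.+1) (ghost p n (wmul p (wshift x) y))
    (ghost p n (wshift (wmul p x (fun i => y i ^+ p)))).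
Proof.
case: n => [|n].
  by rewrite ghost_wmul !ghost_wshift0 mul0r; apply: cong_refl.
rewrite ghost_wmul !ghost_wshiftS ghost_wmul ghost_frob mulrDr.
rewrite -[X in cong _ _ X]addr0 mulrnAl.
apply: congD; first exact: cong_refl.
by rewrite mulrnAl mulrnAr -mulrnA -expnSr; apply: cong0.
Qed.

Lemma wshift_mul a b : wmul p (wshift a) b = wshift (wmul p a (wfrob b)).
Proof.
have [h [x [y [_ [ax bY _]]]]] := generic3 a b b.
have fE : wfrob b = h \o (fun i => y i ^+ p).
  by apply/funext => i; rewrite bY /wfrob /comp (rmorphXn h).
rewrite fE ax bY -(wmul_morph p h x) -!(wshift_morph h) -(wmul_morph p h).
apply/funext => n.
apply: cong_pchar; move: n.
exact: (ghost_cong p_gt0 wpoly_mulrIn (wshift_mul_cong x y)).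
Qed.
End CharP.
End WittTheory.

(* p-typical Witt vectors; the proof pk is a parameter because the ring structure
   and its integrality depend on it. *)
Record witt (p : nat) (k : fieldType) (pk : p \in [pchar k]) :=
  Witt { wcomp : nat -> k }.

Section WittRing.
Variables (p : nat) (k : fieldType) (pk : p \in [pchar k]).
Let pp : prime p := pcharf_prime pk.

Local Notation W := (witt pk).

HB.instance Definition _ := [isNew for @wcomp p k pk].
HB.instance Definition _ := [Choice of W by <:].

Implicit Types x y z : W.

Definition witt_add x y : W := Witt pk (wadd p (wcomp x) (wcomp y)).
Definition witt_mul x y : W := Witt pk (wmul p (wcomp x) (wcomp y)).
Definition witt_opp x : W := Witt pk (wopp p (wcomp x)).
Definition witt_zero : W := Witt pk (@wzero k).
Definition witt_one : W := Witt pk (@wone k).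

Let witt_addA : associative witt_add.
Proof. by move=> x y z; congr Witt; exact: (waddA pp). Qed.
Let witt_addC : commutative witt_add.
Proof. by move=> x y; congr Witt; exact: (waddC pp). Qed.
Let witt_add0 : left_id witt_zero witt_add.
Proof. by move=> [x]; congr Witt; exact: (wadd0 pp). Qed.
Let witt_addN : left_inverse witt_zero witt_opp witt_add.
Proof. by move=> [x]; congr Witt; exact: (waddN pp). Qed.
HB.instance Definition _ :=
  GRing.isZmodule.Build W witt_addA witt_addC witt_add0 witt_addN.

Let witt_mulA : associative witt_mul.
Proof. by move=> x y z; congr Witt; exact: (wmulA pp). Qed.
Let witt_mulC : commutative witt_mul.
Proof. by move=> x y; congr Witt; exact: (wmulC pp). Qed.
Let witt_mul1 : left_id witt_one witt_mul.
Proof. by move=> [x]; congr Witt; exact: (wmul1 pp). Qed.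
Let witt_mulDl : left_distributive witt_mul witt_add.
Proof. by move=> x y z; congr Witt; exact: (wmulDl pp). Qed.
Let witt_one_neq0 : witt_one != 0 :> W.
Proof.
apply/eqP => /(congr1 (fun x => wcomp x 0%N)) /=.
by rewrite /wone /wzero /= => /eqP; rewrite oner_eq0.
Qed.
HB.instance Definition _ := GRing.Zmodule_isComNzRing.Build W
  witt_mulA witt_mulC witt_mul1 witt_mulDl witt_one_neq0.

Let witt_unit : {pred W} := fun x => `[< exists y, y * x = 1 >].
Let witt_inv x : W :=
  if x \in witt_unit then xget 0 [set y | y * x = 1] else x.
Let witt_mulVr : {in witt_unit, left_inverse 1 witt_inv *%R}.
Proof.
move=> x ux; rewrite /witt_inv ux; move/asboolP: ux => [y yx].
by case: xgetP => [z _ //|/(_ y)].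
Qed.
Let witt_unitP x y : y * x = 1 -> x \in witt_unit.
Proof. by move=> yx; apply/asboolP; exists y. Qed.
Let witt_inv_out : {in [predC witt_unit], witt_inv =1 id}.
Proof. by move=> x; rewrite inE /= /witt_inv => /negbTE ->. Qed.
HB.instance Definition _ := GRing.ComNzRing_hasMulInverse.Build W
  witt_mulVr witt_unitP witt_inv_out.

Lemma wshift_iter (a : nat -> k) m n : iter m (@wshift k) a (m + n)%N = a n.
Proof. by elim: m. Qed.

Lemma wfrob_iter0 (a : nat -> k) m : iter m (@wfrob p k) a 0%N = a 0%N ^+ (p ^ m).
Proof.
elim: m => [|m IH]; first by rewrite expn0 expr1.
by rewrite iterS /wfrob IH -exprM -expnSr.
Qed.

Lemma wfrob_shift (a : nat -> k) m :
  iter m (@wfrob p k) (wshift a) = wshift (iter m (@wfrob p k) a).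
Proof.
elim: m => //= m ->; apply/funext => -[|i] //.
by rewrite /wfrob /= expr0n eqn0Ngt (prime_gt0 pp).
Qed.

Lemma wfrob_mul_iter (a b : nat -> k) m :
  iter m (@wfrob p k) (wmul p a b) =
  wmul p (iter m (@wfrob p k) a) (iter m (@wfrob p k) b).
Proof. by elim: m => //= m ->; rewrite (wfrob_mul pk). Qed.

Lemma wshift_mul_iter (a b : nat -> k) m :
  wmul p (iter m (@wshift k) a) b =
  iter m (@wshift k) (wmul p a (iter m (@wfrob p k) b)).
Proof.
elim: m b => // m IH b.
by rewrite iterS (wshift_mul pp pk) IH /= -iterSr.
Qed.

Lemma wfrob_shift_iter (a : nat -> k) m n :
  iter m (@wfrob p k) (iter n (@wshift k) a) =
  iter n (@wshift k) (iter m (@wfrob p k) a).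
Proof. by elim: n => //= n IH; rewrite wfrob_shift IH. Qed.

Lemma wshift_decomp (a : nat -> k) n : a n != 0 ->
  exists m b, a = iter m (@wshift k) b /\ b 0%N != 0.
Proof.
elim: n a => [|n IH] a an; first by exists 0%N, a.
have [a0|a0] := eqVneq (a 0%N) 0; last by exists 0%N, a.
have [m [b [ab b0]]] := IH (fun i => a i.+1) an.
exists m.+1, b; split=> //; rewrite iterS -ab.
by apply/funext => -[|i].
Qed.

Let witt_integral x y : x * y = 0 -> (x == 0) || (y == 0).
Proof.
have nz z : z != 0 -> exists n, wcomp z n != 0.
  move=> z0; apply: contrapT => h; move/eqP: z0; apply.
  case: z h => z h; congr Witt; apply/funext => n.
  by apply/eqP; apply: contrapT => /negP hn; apply: h; exists n.
move=> xy; apply: contrapT => /negP; rewrite negb_or => /andP[].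
move=> /nz[i /wshift_decomp[m [a [xa a0]]]] /nz[j /wshift_decomp[n [b [yb b0]]]].
have : wmul p (wcomp x) (wcomp y) (m + (n + 0))%N = 0.
  by rewrite -[LHS]/(wcomp (x * y) _) xy.
rewrite xa yb wshift_mul_iter wshift_iter wfrob_shift_iter (wmulC pp).
rewrite wshift_mul_iter wshift_iter (wmul_0 pp) !wfrob_iter0.
by apply/eqP; rewrite mulf_neq0 // expf_neq0.
Qed.
HB.instance Definition _ := GRing.ComUnitRing_isIntegral.Build W witt_integral.

End WittRing.

Section HahnSeries.
Variables (R : realType) (G : set R) (A : zmodType).

Definition well_ordered (S : set R) : Prop :=
  forall C, C `<=` S -> C !=set0 -> exists2 m, C m & forall x, C x -> m <= x.

Definition supp (a : R -> A) : set R := [set g | a g != 0].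

Definition hahn_pred : {pred R -> A} :=
  fun a => `[< supp a `<=` G /\ well_ordered (supp a) >].

Lemma well_ordered_sub (S T : set R) :
  S `<=` T -> well_ordered T -> well_ordered S.
Proof. by move=> ST wT C CS; apply: wT; apply: subset_trans ST. Qed.

Lemma well_orderedU (S T : set R) :
  well_ordered S -> well_ordered T -> well_ordered (S `|` T).
Proof.
move=> wS wT C CST [x Cx].
have [CS0|/nonemptyPn CS0] := pselect ((C `&` S) !=set0); last first.
  apply: wT; last by exists x.
  by move=> y Cy; case: (CST y Cy) => // Sy; have : (C `&` S) y by []; rewrite CS0.
have [CT0|/nonemptyPn CT0] := pselect ((C `&` T) !=set0); last first.
  apply: wS; last by exists x.
  by move=> y Cy; case: (CST y Cy) => // Sy; have : (C `&` T) y by []; rewrite CT0.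
have [m [Cm Sm] ms] := wS _ (@subIsetr _ C S) CS0.
have [n [Cn Tn] nt] := wT _ (@subIsetr _ C T) CT0.
exists (Num.min m n); first by rewrite minEle; case: ifP.
move=> y Cy; rewrite ge_min; case: (CST y Cy) => [Sy|Ty].
  by rewrite ms.
by rewrite nt ?orbT.
Qed.

Lemma hahn_zmod_closed : zmod_closed hahn_pred.
Proof.
split.
  apply/asboolP; split=> [g|C C0 [x /C0]]; by rewrite /supp /= eqxx.
move=> a b /asboolP[aG aw] /asboolP[bG bw].
have sub : supp (a - b) `<=` supp a `|` supp b.
  move=> g; rewrite /supp /= => abg; apply: contrapT => /not_orP[].
  move=> /negP; rewrite negbK => /eqP ag /negP; rewrite negbK => /eqP bg.
  by move: abg; rewrite -[(a - b) g]/(a g - b g) ag bg subrr eqxx.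
apply/asboolP; split; first by move=> g /sub[/aG|/bG].
by apply: (well_ordered_sub sub); apply: well_orderedU.
Qed.
HB.instance Definition _ :=
  GRing.isZmodClosed.Build (R -> A) hahn_pred hahn_zmod_closed.

(* The elements of H(G, A) are extended by 0 to the whole real line. The product
   is left out: the distances below only involve differences of series. *)
Record hahn := Hahn { coef :> R -> A; _ : coef \in hahn_pred }.
HB.instance Definition _ := [isSub for coef].
HB.instance Definition _ := [Choice of hahn by <:].
HB.instance Definition _ := [SubChoice_isSubZmodule of hahn by <:].

(* The infimum of the empty set being +oo, this is +oo for a = 0. *)
Definition min_supp (a : hahn) : \bar R := ereal_inf (EFin @` supp a).

End HahnSeries.

Section PadicHahn.
Variables (R : realType) (G : set R).
Variables (p : nat) (k : fieldType) (pk : p \in [pchar k]).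
Local Notation W := (witt pk).
Local Notation FrW := {fraction W}.

(* Convergence to 0 of the series indexed by int, both ends being independent;
   the p ^+ e * W are the basic neighbourhoods of 0 in Fr W. *)
Definition padic_sum_eq0 (u : int -> FrW) : Prop :=
  forall e : nat, exists N : nat, forall m n : nat, (N <= m)%N -> (N <= n)%N ->
    exists w : W, \sum_(i < m + n) u (i%:Z - m%:Z) = p%:R ^+ e * tofrac w.

Definition padic_null : {pred hahn G W} := fun a =>
  `[< forall g, G g ->
        padic_sum_eq0 (fun n : int => tofrac (a (g + n%:~R)) * p%:R ^ n) >].

Lemma padic_null_zmod_closed : zmod_closed padic_null.
Proof.
split.
  apply/asboolP => g Gg e; exists 0%N => m n _ _; exists (0 : W).
  have -> : p%:R ^+ e * tofrac (0 : W) = 0 by rewrite tofrac0 mulr0.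
  apply: big1 => i _; have t0 := tofrac0 W.
  by rewrite -[(0 : hahn G W) _]/(0 : W) t0 mul0r.
move=> a b /asboolP ha /asboolP hb; apply/asboolP => g Gg e.
have [M hM] := ha g Gg e; have [N hN] := hb g Gg e.
exists (maxn M N) => m n; rewrite !geq_max => /andP[Mm Nm] /andP[Mn Nn].
have [w aw] := hM m n Mm Mn; have [z bz] := hN m n Nm Nn.
exists (w - z); rewrite tofracB mulrBr -aw -bz -sumrB; apply: eq_bigr => i _.
by rewrite -mulrBl -tofracB.
Qed.
HB.instance Definition _ :=
  GRing.isZmodClosed.Build (hahn G W) padic_null padic_null_zmod_closed.

Definition padic_hahn : zmodType := Quotient.quot padic_null.

Definition complete_reps (J : set W) : Prop :=
  J 0 /\ set_bij J [set: k] (fun w => wcomp w 0%N).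

Variable J : set W.

Definition std_series (a : hahn G W) : hahn G W :=
  xget 0 [set b | a - b \in padic_null /\ forall g, J (b g)].

Definition padic_val (x : padic_hahn) : \bar R := min_supp (std_series (repr x)).

End PadicHahn.

Record valuedGroup (R : realType) :=
  ValuedGroup { vcarrier :> zmodType; vval : vcarrier -> \bar R }.

(* The proof that k has characteristic p, on which the p-adic Hahn field
   depends, is extracted from the decision of p \in [pchar k]; the last branch
   is never taken when q <> p, q = 0 and k has characteristic p > 0. *)
Definition hahn_field (R : realType) (G : set R) (q p : nat) (k : fieldType)
    (J : forall pk : p \in [pchar k], set (witt pk)) : valuedGroup R :=
  if q == p then ValuedGroup (@min_supp R G k) else
  match @idP (p \in [pchar k]) with
  | ReflectT pk => ValuedGroup (@padic_val R G p k pk (J pk))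
  | ReflectF _ => ValuedGroup (@min_supp R G k)
  end.

(* eta ^ (- v), with eta ^ (- +oo) = 0; -oo is not a value. *)
Definition exp_val (R : realType) (eta : R) (v : \bar R) : R :=
  if v is r%:E then eta `^ (- r) else 0.

Definition val_dist (R : realType) (eta : R) (A : valuedGroup R) (x y : A) : R :=
  exp_val eta (vval (x - y)).

Section Urysohn.
Variable R : realType.
Implicit Types (D S T : set R) (X A B V : metricType R).

Definition isometric_embedding X V (f : X -> V) : Prop :=
  forall x y, mdist (f x) (f y) = mdist x y.

Definition ultrametric X : Prop :=
  forall x y z : X, mdist x z <= Num.max (mdist x y) (mdist y z).

Definition valued_in D X : Prop := forall x y : X, D (mdist x y).

(* metricType allows the empty space. *)
Definition ultrametric_valued D X : Prop :=
  [set: X] !=set0 /\ ultrametric X /\ valued_in D X.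

Definition finite_ultrametric_valued D X : Prop :=
  finite_set [set: X] /\ ultrametric_valued D X.

Definition injective_for D X : Prop :=
  forall A B, finite_ultrametric_valued D A -> finite_ultrametric_valued D B ->
  forall (phi : A -> B) (psi : A -> X),
    isometric_embedding phi -> isometric_embedding psi ->
  exists theta : B -> X, isometric_embedding theta /\ theta \o phi = psi.

Definition separable X : Prop := exists C : set X, countable C /\ dense C.

Definition complete X : Prop :=
  forall F : set_system X, ProperFilter F -> cauchy F -> exists x : X, F --> x.

Definition countable_urysohn D X : Prop :=
  [/\ ultrametric_valued D X, separable X, complete X & injective_for D X].

Definition tenuous S : Prop :=
  (forall s, S s -> 0 <= s) /\
  (finite_set S \/
   exists a : nat -> R, [/\ forall i, 0 < a i,
     forall i j, (i < j)%N -> a j < a i, a @ \oo --> 0 & S = [set 0] `|` range a]).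

Definition TEN D S : Prop := [/\ tenuous S, S `<=` D & S 0].

Definition petaloid D X : Prop :=
  ultrametric_valued D X /\
  exists Pi : set R -> set X,
  [/\ forall S, TEN D S -> exists V, countable_urysohn S V /\
        exists f : V -> X, isometric_embedding f /\ range f = Pi S,
      \bigcup_(S in TEN D) Pi S = [set: X],
      forall S T, TEN D S -> TEN D T -> Pi S `&` Pi T = Pi (S `&` T) &
      forall S T x, TEN D S -> TEN D T -> Pi T x ->
        ((T `\` S) `|` [set 0]) (inf [set mdist x a | a in Pi S])].

(* These properties characterize the D-Urysohn universal space up to isometry. *)
Definition urysohn_universal D V : Prop :=
  (countable D /\ countable_urysohn D V) \/ (~ countable D /\ petaloid D V).

Definition isometric_to (X : Type) (d : X -> X -> R) V : Prop :=
  exists f : X -> V, bijective f /\ forall x y, mdist (f x) (f y) = d x y.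

Definition exp_range (eta : R) (G : set R) : set R :=
  [set 0] `|` [set eta `^ (- g) | g in G].

Definition real_subgroup (G : set R) : Prop :=
  G 0 /\ forall x y, G x -> G y -> G (x - y).

Definition order_isomorphic_int (G : set R) : Prop :=
  exists f : int -> R, (forall m n, (f m <= f n) = (m <= n)) /\ range f = G.

End Urysohn.

(* [pchar k] only contains primes. *)
Definition has_characteristic (k : fieldType) (p : nat) : Prop :=
  (p = 0%N /\ [pchar k] =i pred0) \/ p \in [pchar k].

Definition perfect_field (k : fieldType) (p : nat) : Prop :=
  p = 0%N \/ forall x : k, exists y : k, y ^+ p = x.

(* Main.v *)
(* In both cases the field is the set of Hahn series with coefficients in a
   countably infinite set J, where d(x, y) = eta ^ (- g) for g the first exponent
   at which x and y differ; in the p-adic case these are the standard series. Such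
   a space is spherically complete for sequences, and each of its closed balls of
   radius r in R, r > 0, splits into infinitely many open balls of radius r.
   If G is order-isomorphic to Z, this gives completeness, separability and
   one-point extensions. Otherwise G has a strictly decreasing sequence of positive
   elements, hence R has a strictly decreasing sequence (r_n) bounded away from 0.
   A separable N(R)-injective space is then not spherically complete, by
   diagonalisation; nor is a petaloid one: if x_n lies in the petal of
   {0, r_0, ..., r_(n-1)} and d(x_n, x_(n+1)) = r_n, a limit of (x_n) would lie in a
   petal Pi(X, T) with all the r_n in T, so T would not be tenuous. *)
Require Import Defs.
From HB Require Import structures.
From mathcomp Require Import all_boot all_order all_algebra.
From mathcomp Require Import all_classical all_reals all_analysis.
From mathcomp Require Import generic_quotient.
Import Order.TTheory GRing.Theory Num.Theory.
Local Open Scope classical_set_scope.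
Local Open Scope ring_scope.

Set Implicit Arguments.
Unset Strict Implicit.
Unset Printing Implicit Defensive.

(** * Metric spaces *)

Section MetricOfDistance.
Variables (R : realType) (T : choiceType).

Definition distance (d : T -> T -> R) :=
  [/\ forall x, d x x = 0, forall x y, d x y = 0 -> x = y,
      forall x y, d x y = d y x & forall y x z, d x z <= d x y + d y z].

(** The proof [dd] is kept as a phantom argument: it selects the metric, so one carrier can bear
    several of them. *)
Definition distance_space d (dd : distance d) : Type := T.

Variables (d : T -> T -> R) (dd : distance d).
Let d0 x : d x x = 0. Proof. by case: dd. Qed.
Let d_pos x y : d x y = 0 -> x = y. Proof. by case: dd => _ + _ _; apply. Qed.
Let d_sym x y : d x y = d y x. Proof. by case: dd. Qed.
Let d_tri y x z : d x z <= d x y + d y z. Proof. by case: dd. Qed.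

HB.instance Definition _ := Choice.copy (distance_space dd) T.
HB.instance Definition _ := isMetric.Build R (distance_space dd) d0 d_pos d_sym d_tri.

End MetricOfDistance.

Lemma ultra_distance (R : realType) (T : choiceType) (d : T -> T -> R) :
  (forall x y, 0 <= d x y) -> (forall x, d x x = 0) ->
  (forall x y, d x y = 0 -> x = y) -> (forall x y, d x y = d y x) ->
  (forall x y z, d x z <= Num.max (d x y) (d y z)) -> distance d.
Proof.
move=> d_ge0 d0 dp ds du; split=> // y x z; apply: (le_trans (du x y z)).
by rewrite ge_max lerDl lerDr !d_ge0.
Qed.

(** * Spherical completeness, splitting of balls, and injectivity *)

Section UrysohnCriteria.
Variable R : realType.
Implicit Types (D : set R) (X : metricType R).

(** In an ultrametric space the balls involved are nested. Their radii need not tend to 0, which is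
    where this exceeds completeness. *)
Definition seq_spherical D X := forall (r : nat -> R) (x : nat -> X),
  (forall n, D (r n)) -> (forall n, 0 < r n.+1 < r n) ->
  (forall n, mdist (x n) (x n.+1) <= r n) ->
  exists y, forall n, mdist y (x n) <= r n.

(** The [rho i] are centres of the open balls of radius [r] that partition a closed one. Their
    infinite number gives extensions, their countability separability. *)
Definition residual D X := forall (x : X) r, D r -> 0 < r ->
  exists rho : nat -> X,
    [/\ forall i, mdist x (rho i) <= r,
        forall i j, i != j -> mdist (rho i) (rho j) = r &
        forall y, mdist x y <= r -> exists i, mdist y (rho i) < r].

Lemma ultrametric_isosceles X (x y z : X) : ultrametric X ->
  mdist x y < mdist y z -> mdist x z = mdist y z.
Proof.
move=> uX xy; apply/eqP; rewrite eq_le; apply/andP; split.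
  by have := uX x y z; rewrite (max_idPr (ltW xy)).
have := uX y x z; rewrite metric_sym in xy.
by rewrite le_max leNgt xy.
Qed.

Lemma exists_avoiding (T : eqType) (P : T -> nat -> Prop) (s : seq T) :
  (forall c i j, P c i -> P c j -> i = j) ->
  exists i, forall c, c \in s -> ~ P c i.
Proof.
(* Strengthened to all large indices, so that the induction only takes a maximum. *)
move=> Pu; suff [N NP] : exists N, forall i c, (N <= i)%N -> c \in s -> ~ P c i.
  by exists N => c; apply: NP.
elim: s => [|c s [N NP]]; first by exists 0%N.
have [[j Pj]|no] := pselect (exists j, P c j).
  exists (maxn N j.+1) => i c'; rewrite geq_max inE => /andP[Ni ji] /predU1P[->|cs].
    by move=> /Pu/(_ Pj) ij; rewrite ij ltnn in ji.
  exact: NP.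
exists N => i c' Ni; rewrite inE => /predU1P[-> Pi|]; last exact: NP.
by apply: no; exists i.
Qed.

Lemma seq_argmin (T : eqType) (s : seq T) (f : T -> R) : s != [::] ->
  exists2 c, c \in s & forall x, x \in s -> f c <= f x.
Proof.
case: s => // a s _; elim: s a => [|b s IH] a.
  by exists a; rewrite ?mem_head // => x; rewrite inE => /eqP ->.
have [c cs cP] := IH b; have [ac|/ltW ca] := leP (f a) (f c).
  exists a; first exact: mem_head.
  by move=> x; rewrite inE => /predU1P[-> //|/cP]; apply: le_trans.
exists c; first by rewrite inE cs orbT.
by move=> x; rewrite inE => /predU1P[-> //|/cP].
Qed.

(** Let [r] be the distance from [b] to a nearest point [c0] of [s]. Each [f c] lies in at most one
    of the open balls that split the closed ball of radius [r] about [f c0], so some centre [rho i]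
    avoids all of them. It is at distance [r] from the images of the nearest points; the isosceles
    property settles the farther ones. *)
Lemma one_point_extension D X (B : metricType R) (s : seq B) (f : B -> X) b :
  ultrametric X -> residual D X -> ultrametric B -> valued_in D B ->
  s != [::] ->
  (forall x y, x \in s -> y \in s -> mdist (f x) (f y) = mdist x y) ->
  exists x, forall c, c \in s -> mdist x (f c) = mdist b c.
Proof.
move=> uX resX uB vB s0 fs.
have [bs|bs] := boolP (b \in s); first by exists (f b) => c cs; apply: fs.
have [c0 c0s c0P] := seq_argmin (mdist b) s0.
set r := mdist b c0 in c0P.
have r0 : 0 < r by rewrite mdist_gt0; apply: contraNneq bs => ->.
have [rho [rho_le rho_eq _]] := resX (f c0) r (vB b c0) r0.
have [|i iP] := @exists_avoiding _ (fun c i => mdist (rho i) (f c) < r) s.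
  move=> c i j ic jc; apply: contrapT => /eqP/rho_eq ij.
  have := uX (rho i) (f c) (rho j); rewrite ij (metric_sym (f c)).
  by rewrite leNgt gt_max ic jc.
have ge c : c \in s -> r <= mdist (rho i) (f c) by move=> /iP/negP; rewrite -leNgt.
have i0 : mdist (rho i) (f c0) = r.
  by apply/eqP; rewrite eq_le ge // metric_sym rho_le.
exists (rho i) => c cs.
have := c0P c cs; rewrite le_eqVlt => /predU1P[rc|rc].
  rewrite -rc; apply/eqP; rewrite eq_le ge // andbT.
  apply: (le_trans (uX _ (f c0) _)); rewrite i0 ge_max lexx fs //.
  by apply: (le_trans (uB _ b _)); rewrite -rc ge_max (metric_sym c0) !lexx.
have bc : mdist c0 c = mdist b c.
  by rewrite (ultrametric_isosceles (y := b)) // (metric_sym c0).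
by rewrite (ultrametric_isosceles (y := f c0)) ?i0 ?fs ?bc.
Qed.

Lemma residual_injective D X :
  ultrametric X -> residual D X -> injective_for D X.
Proof.
move=> uX resX A B [finA [A0 _]] [finB [_ [uB vB]]] phi psi iphi ipsi.
have phi_inj : injective phi.
  move=> x y /(congr1 (mdist (phi x))); rewrite mdistxx iphi => /esym.
  exact: mdist_positivity.
have [sA sAE] := (finite_seqP _).1 finA; have [sB sBE] := (finite_seqP _).1 finB.
have inA a : a \in sA by have : [set: A] a by []; rewrite sAE.
have inB b : b \in sB by have : [set: B] b by []; rewrite sBE.
have [a0 _] := A0.
have [g gK] : exists g : B -> A, cancel phi g.
  exists (fun b => xget a0 [set a | phi a = b]) => a.
  by case: xgetP => [a' _ /= /phi_inj|/(_ a)/(_ erefl)].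
(* The points of [B] are added one at a time; keeping the image of [A] in the list makes it nonempty
   and fixes [f] on that image. *)
suff [f [f_phi fP]] : exists f : B -> X, (forall a, f (phi a) = psi a) /\
    forall x y, x \in sB ++ map phi sA -> y \in sB ++ map phi sA ->
      mdist (f x) (f y) = mdist x y.
  exists f; split; last exact/funext.
  by move=> x y; apply: fP; rewrite mem_cat inB.
elim: sB {sBE inB} => [|b s [f [f_phi fP]]].
  exists (psi \o g); split=> [a|x y]; first by rewrite /= gK.
  by move=> /mapP[a _ ->] /mapP[a' _ ->]; rewrite /= !gK ipsi iphi.
have ne : s ++ map phi sA != [::].
  by have := inA a0; case: (sA) => // *; case: (s).
have [x xP] := one_point_extension b uX resX uB vB ne fP.
have [bs|bs] := boolP (b \in s ++ map phi sA).
  exists f; split=> // y z; rewrite !inE => /predU1P[->|ys] /predU1P[->|zs]; exact: fP.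
exists (fun y => if y == b then x else f y); split=> [a|y z].
  case: eqP => [ab|_ //]; move: bs; rewrite -ab mem_cat map_f ?orbT //.
have nb y' : y' \in s ++ map phi sA -> (y' == b) = false.
  by move=> ys; apply: contraNF bs => /eqP <-.
rewrite !inE => /predU1P[->|ys] /predU1P[->|zs]; rewrite ?eqxx ?nb ?mdistxx //.
- exact: xP.
- by rewrite metric_sym xP // metric_sym.
- exact: fP.
Qed.

End UrysohnCriteria.

(** * The Urysohn space of a range indexed by the integers *)

Section DiscreteRange.
Variables (R : realType) (D : set R) (X : metricType R) (a : int -> R).
Hypotheses (DE : D = [set 0] `|` range a) (a_gt0 : forall m, 0 < a m).
Hypothesis a_lt : forall m n, (a m < a n) = (n < m).
Hypothesis a_small : forall e, 0 < e -> exists m, a m < e.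
Hypotheses (X0 : [set: X] !=set0) (uX : ultrametric X) (vX : valued_in D X).
Hypotheses (resX : residual D X) (sphX : seq_spherical D X).

Lemma discrete_step (x y : X) m : mdist x y < a m -> mdist x y <= a (m + 1).
Proof.
have := vX x y; rewrite DE => -[->|[n _ <-]]; first by rewrite ltW.
by rewrite a_lt => mn; rewrite leNgt a_lt -leNgt lezD1.
Qed.

(** A point is approached from [x0] by choosing, at each level, the open ball that contains it;
    finitely many choices reach any precision, and the finite lists of choices are countable. *)
Lemma discrete_separable : separable X.
Proof.
have [x0 _] := X0.
have [rho rhoP] : exists rho : X * int -> nat -> X,
    forall xm y, mdist xm.1 y <= a xm.2 -> exists i, mdist y (rho xm i) < a xm.2.
  suff /choice[rho rhoP] : forall xm : X * int, exists rho : nat -> X,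
      forall y, mdist xm.1 y <= a xm.2 -> exists i, mdist y (rho i) < a xm.2.
    by exists rho.
  move=> [x m]; have [||rho [_ _ rhoP]] := resX x (r := a m) => //.
    by rewrite DE; right; exists m.
  by exists rho.
pose approx (l : seq (int * nat)) := foldl (fun x mi => rho (x, mi.1) mi.2) x0 l.
exists (range approx); split.
  exact: sub_countable (card_image_le _ _) (countableP _).
move=> O [x Ox] oO; have [e /= e0 xe] := (nbhs_ballP x O).1 (open_nbhs_nbhs (conj oO Ox)).
suff [l xl] : exists l, mdist x (approx l) < e.
  by exists (approx l); split; [apply: xe; rewrite ballEmdist|exists l].
have := vX x x0; rewrite DE => -[x00|[m _ mE]].
  by exists [::]; rewrite /= x00.
have ap n : exists l, mdist x (approx l) <= a (m + n%:Z).
  elim: n => [|n [l xl]]; first by exists [::]; rewrite addr0 mE.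
  have [|i xi] := rhoP (approx l, m + n%:Z) x; first by rewrite metric_sym.
  exists (rcons l (m + n%:Z, i)); rewrite /approx -cats1 foldl_cat /=.
  by rewrite -addn1 PoszD addrA discrete_step.
(* The absolute value turns the gap into a number of steps that ends at level [N] or beyond. *)
have [N Ne] := a_small e0; have [l xl] := ap `|N - m|%N; exists l.
apply: (le_lt_trans xl); apply: (le_lt_trans _ Ne).
by rewrite leNgt a_lt -leNgt -lerBlDl abszE ler_norm.
Qed.

(** A Cauchy filter contains a ball of radius [a n] for each [n]; any two of them meet, so their
    centres form a spherical sequence. *)
Lemma discrete_complete : complete X.
Proof.
move=> F FF /cauchyP cF.
have [x xF] : exists x : nat -> X, forall n : nat, F (ball (x n) (a n)).
  suff /choice[x xF] : forall n : nat, exists x, F (ball x (a n)) by exists x.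
  by move=> n; apply: cF.
have dec n : a n.+1 < a n by rewrite a_lt ltz_nat.
have [||n|y yP] := sphX (r := fun n => a n) (x := x).
- by move=> n; rewrite DE; right; exists n%:Z.
- by move=> n; rewrite a_gt0 dec.
- have [z []] := filter_ex (filterI (xF n) (xF n.+1)).
  rewrite !ballEmdist /= => nz Snz; apply: (le_trans (uX _ z _)).
  by rewrite ge_max ltW //= metric_sym ltW // (lt_trans Snz).
exists y => O /nbhs_ballP[e /= e0 yO]; apply: filterS yO _.
have [N Ne] := a_small e0.
have an : a `|N|%N < e.
  by apply: (le_lt_trans _ Ne); rewrite leNgt a_lt -leNgt abszE ler_norm.
apply: filterS (xF `|N|%N) => z; rewrite !ballEmdist /= => nz.
apply: (le_lt_trans (uX _ (x `|N|%N) _)).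
by rewrite gt_max (le_lt_trans (yP _)) //= (lt_trans nz).
Qed.

Lemma discrete_urysohn : countable_urysohn D X.
Proof.
split; [by [] |exact: discrete_separable|exact: discrete_complete|].
exact: residual_injective.
Qed.

End DiscreteRange.

(** * Spherical completeness against universality *)

Section NotUniversal.
Variable R : realType.
Implicit Types (D S T : set R) (X : metricType R).

Definition two_point_dist (s : R) (b c : bool) : R := if b == c then 0 else s.

Lemma two_point_distP s : 0 < s -> distance (two_point_dist s).
Proof.
move=> s0; apply: ultra_distance; rewrite /two_point_dist.
- by move=> [] [] /=; rewrite ?lexx ?ltW.
- by move=> [].
- by move=> [] [] //= s00; move: s0; rewrite s00 ltxx.
- by move=> [] [].
- by move=> [] [] []; rewrite /= le_max ?lexx ?orbT // ltW.
Qed.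

Lemma one_point_distP : distance (fun _ _ : unit => 0 : R).
Proof. by split=> [|[] []||_ _ _]; rewrite ?addr0. Qed.

(** Injectivity is applied to the inclusion of a point into a two-point space of diameter [s]. *)
Lemma injective_sphere D X (x : X) s : D 0 -> injective_for D X -> D s -> 0 < s ->
  exists y, mdist x y = s.
Proof.
move=> D0 injX Ds s0.
pose A : metricType R := distance_space one_point_distP.
pose B : metricType R := distance_space (two_point_distP s0).
have AE (b c : A) : mdist b c = 0 by [].
have BE (b c : B) : mdist b c = if b == c then 0 else s by [].
have [|||| theta [iso tE]] := injX A B _ _ (fun=> true) (fun=> x).
- split; first by apply: (@finite_finset unit).
  by split; [exists tt|split=> [? ? ?|? ?]]; rewrite ?AE ?maxxx.
- split; first by apply: (@finite_finset bool).
  split; first by exists true.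
  split=> [|b c]; last by rewrite BE; case: ifP.
  by move=> [] [] []; rewrite !BE /= le_max ?lexx ?orbT // ltW.
- by move=> *; rewrite mdistxx.
- by move=> *; rewrite mdistxx.
exists (theta false); have := iso true false; rewrite BE /= => <-.
by rewrite -[x]/((fun=> x) (tt : A)) -tE.
Qed.

Variables (D : set R) (X : metricType R) (r : nat -> R) (c : R).
Hypotheses (D0 : D 0) (sphX : seq_spherical D X) (Dr : forall n, D (r n)).
Hypotheses (r_dec : forall n, r n.+1 < r n) (c0 : 0 < c) (r_gt : forall n, c < r n).

Let r_gt0 n : 0 < r n. Proof. exact: lt_trans (r_gt n). Qed.

Let r_lt m n : (m < n)%N -> r n < r m.
Proof.
elim: n => // n IH; rewrite ltnS leq_eqVlt => /predU1P[->|/IH]; first exact: r_dec.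
exact: lt_trans.
Qed.

Let r_inj : injective r.
Proof.
move=> m n rmn; have [/r_lt|/r_lt|//] := ltngtP m n; by rewrite rmn ltxx.
Qed.

Let spherical_limit (x : nat -> X) : (forall n, mdist (x n) (x n.+1) <= r n) ->
  exists y, forall n, mdist y (x n) <= r n.
Proof. by move=> xr; apply: sphX => // n; rewrite r_gt0 r_dec. Qed.

(* Diagonalisation against a dense sequence (z n): x n.+1 is moved at distance at
   least r n from z n, and this survives in the limit. *)
Lemma not_separable : ultrametric X -> [set: X] !=set0 -> injective_for D X ->
  ~ separable X.
Proof.
move=> uX [x0 _] injX [C [/countable_injP[f f_inj] dC]].
(* Indices outside the range of [f] get the harmless value [x0]. *)
pose z n := xget x0 [set y | C y /\ f y = n].
have zP y : C y -> z (f y) = y.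
  move=> Cy; rewrite /z; case: xgetP => [w _ [Cw wy]|/(_ y)]; last by case.
  by apply: f_inj; rewrite ?inE.
(* Either [x] is already far from [z n], or a point at distance [r n] from [x] is, by the isosceles
   property. *)
have [step stepP] : exists step : nat * X -> X, forall nx,
    mdist nx.2 (step nx) <= r nx.1 /\ r nx.1 <= mdist (step nx) (z nx.1).
  pose P (nx : nat * X) y := mdist nx.2 y <= r nx.1 /\ r nx.1 <= mdist y (z nx.1).
  suff /choice[step stepP] : forall nx, exists y, P nx y by exists step.
  move=> [n x]; rewrite /P; have [le|lt] /= := leP (r n) (mdist x (z n)).
    by exists x; rewrite mdistxx ltW.
  have [y xy] := injective_sphere x D0 injX (Dr n) (r_gt0 n).
  have zx : mdist (z n) x < mdist x y by rewrite xy metric_sym.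
  by exists y; rewrite (metric_sym y) (ultrametric_isosceles uX zx) xy.
pose fix x n := if n is m.+1 then step (m, x m) else x0.
have [|y yP] := spherical_limit (x := x); first by move=> n; exact: (stepP (n, x n)).1.
have [||w [yw Cw]] := dC ((ball y c)^°).
- by exists y; apply: nbhsx_ballx.
- exact: open_interior.
move/interior_subset: yw; rewrite ballEmdist /=; apply/negP; rewrite -leNgt.
have zw := (stepP (f w, x (f w))).2; rewrite /= zP // in zw.
apply: (le_trans (ltW (r_gt (f w)))).
(* The limit is within [r n.+1 < r n] of [x n.+1], so both are equally far from [z n], here with
   [n = f w]. *)
rewrite (ultrametric_isosceles (y := x (f w).+1)) //.
by apply: (le_lt_trans (yP _)); apply: lt_le_trans zw.
Qed.

Let S n : set R := [set 0] `|` [set r i | i in `I_n].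

Let TEN_S n : TEN D (S n).
Proof.
split; last by left.
  split; last by left; rewrite finite_setU; split; [exact: finite_set1|apply: finite_image; exact: finite_II].
  by move=> s [->|[i _ <-]] //; apply: ltW.
by move=> s [->|[i _ <-]].
Qed.

Let S_sub n : S n `&` S n.+1 = S n.
Proof.
apply/setIidl => s [->|[i /= ni <-]]; [by left|right; exists i => //=].
exact: ltnW.
Qed.

(** A tenuous set accumulates only at 0, so it has finitely many elements above [c], whereas the
    [r n] are distinct and all exceed [c]. *)
Lemma tenuous_bounded T : tenuous T -> ~ (forall n, T (r n)).
Proof.
move=> [_ tenT] Tr; have fin : finite_set [set s | T s /\ c < s].
  case: tenT => [finT|[a [_ _ a_cvg ->]]]; first by apply: sub_finite_set finT => s [].
  have /cvgrPdist_lt/(_ c c0) [N _ aN] := a_cvg.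
  apply: (@sub_finite_set _ _ (a @` `I_N)); last by apply: finite_image; exact: finite_II.
  move=> s [[->|[i _ <-]] cs]; first by have := lt_trans c0 cs; rewrite ltxx.
  exists i => //=; rewrite ltnNge; apply/negP => /aN /=.
  by rewrite sub0r normrN ltNge (le_trans (ltW cs)) // ler_norm.
apply: infinite_nat; rewrite -(@eq_finite_set _ _ (range r)).
  by apply: sub_finite_set fin => _ [n _ <-].
by apply: inj_card_eq; move=> m n _ _; apply: r_inj.
Qed.

Lemma not_petaloid : ~ petaloid D X.
Proof.
move=> [[_ [uX _]] [Pi [P1 P2 P3 P4]]].
have Pi_val T x y : TEN D T -> Pi T x -> Pi T y -> T (mdist x y).
  move=> tT; have [V [[[_ [_ vV]] _ _ _] [f [f_iso <-]]]] := P1 T tT.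
  by move=> [v _ <-] [w _ <-]; rewrite f_iso; apply: vV.
have Pi_sub n x : Pi (S n) x -> Pi (S n.+1) x.
  by move=> Sx; have := P3 (S n) (S n.+1) (TEN_S _) (TEN_S _); rewrite S_sub => /seteqP[_ /(_ x Sx)[]].
have [step stepP] : exists step : nat * X -> X, forall nx, Pi (S nx.1) nx.2 ->
    Pi (S nx.1.+1) (step nx) /\ mdist nx.2 (step nx) = r nx.1.
  pose P (nx : nat * X) y := Pi (S nx.1) nx.2 ->
    Pi (S nx.1.+1) y /\ mdist nx.2 y = r nx.1.
  suff /choice[step stepP] : forall nx, exists y, P nx y by exists step.
  move=> [n x]; rewrite /P /=.
  have [Sx|] := pselect (Pi (S n) x); last by exists x.
  have [V [[_ _ _ injV] [f [f_iso fE]]]] := P1 (S n.+1) (TEN_S _).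
  have := Pi_sub n x Sx; rewrite -fE => -[v _ vx].
  have Sr : S n.+1 (r n) by right; exists n => /=.
  have [w vw] := injective_sphere v (or_introl (erefl 0)) injV Sr (r_gt0 n).
  by exists (f w) => _; split; [exists w|rewrite -vx f_iso].
have [x0 Px0] : exists x, Pi (S 0) x.
  have [V [[[[v _] _] _ _ _] [f [_ <-]]]] := P1 (S 0) (TEN_S _).
  by exists (f v), v.
pose fix x n := if n is m.+1 then step (m, x m) else x0.
have Px n : Pi (S n) (x n) by elim: n => //= n /(stepP (n, _))[].
have xr n : mdist (x n) (x n.+1) = r n by case: (stepP (n, x n) (Px n)).
have [|y yP] := spherical_limit (x := x); first by move=> n; rewrite xr.
have [T tT Ty] : (\bigcup_(T in TEN D) Pi T) y by rewrite P2.
apply: (tenuous_bounded (T := T)) => [|n]; first by case: tT.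
(* This distance lies in [S n.+1], whose least positive element is [r n]. It is not 0, for otherwise
   [r n], the distance from [x n] to [x n.+1], would belong to [S n]. *)
have far z : Pi (S n) z -> r n <= mdist (x n.+1) z.
  move=> Sz; have [xz|[i /= ni <-]] := Pi_val _ _ _ (TEN_S _) (Px n.+1) (Pi_sub _ _ Sz).
    have := Pi_val _ _ _ (TEN_S n) (Px n) Sz; rewrite -(mdist_positivity _ _ xz) xr.
    by case=> [rn0|[i /= ni /r_inj ii]]; [have := r_gt0 n; rewrite rn0 ltxx|rewrite ii ltnn in ni].
  by move: ni; rewrite ltnS leq_eqVlt => /predU1P[-> //|/r_lt/ltW].
have far_y z : Pi (S n) z -> r n <= mdist y z.
  move=> Sz; have xz := far z Sz; rewrite (ultrametric_isosceles (y := x n.+1)) //.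
  by apply: (le_lt_trans (yP _)); apply: lt_le_trans xz.
have yx : mdist y (x n) = r n by apply/eqP; rewrite eq_le yP far_y.
have infE : inf [set mdist y z | z in Pi (S n)] = r n.
  apply/eqP; rewrite eq_le; apply/andP; split.
    rewrite -yx; apply: ge_inf; last by exists (x n).
    by exists (r n) => _ [z Sz <-]; apply: far_y.
  apply: lb_le_inf; first by exists (mdist y (x n)), (x n).
  by move=> _ [z Sz <-]; apply: far_y.
(* The distance from [y] to the petal of [S n] is [r n > 0], so (P4) puts [r n] in [T]. *)
have := P4 (S n) T y (TEN_S n) tT Ty; rewrite infE => -[[]//|rn0].
by have := r_gt0 n; rewrite rn0 ltxx.
Qed.

Lemma not_urysohn_universal : ~ urysohn_universal D X.
Proof.
case=> [[_ [[X0 [uX _]] sepX _ injX]]|[_ /not_petaloid //]].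
exact: not_separable sepX.
Qed.

End NotUniversal.

(** * Hahn series *)

Section RealSets.
Variables (R : realType) (G : set R).
Hypotheses (G_subgroup : real_subgroup G) (Z_sub_G : forall n : int, G (n%:~R)).

Lemma real_subgroupD x y : G x -> G y -> G (x + y).
Proof.
case: G_subgroup => G0 GB Gx Gy; rewrite -[y]opprK; apply: (GB) => //.
by rewrite -sub0r; apply: GB.
Qed.

Lemma real_subgroupDn x (n : nat) : G x -> G (x + n%:R).
Proof. by move=> Gx; apply: real_subgroupD => //; apply: (Z_sub_G n). Qed.

Lemma subr1Bn (g : R) i : g - 1 - i%:R = g - i.+1%:R.
Proof. by rewrite -addrA -opprD nat1r. Qed.

(** The positions reached by carries that start in [S] and move up by units. *)
Definition shift_supp (S : set R) : set R :=
  [set g | exists i : nat, S (g - i%:R)].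

(** Below a given [c], only finitely many translates of [S] contribute, and a finite union of
    well-ordered sets is well-ordered. *)
Lemma well_ordered_shift S : well_ordered S -> well_ordered (shift_supp S).
Proof.
move=> wS C CS [c Cc].
have [i Si] := CS c Cc.
have [m Sm mP] := wS S (@subset_refl _ _) (ex_intro _ _ Si).
pose T n := [set g | exists2 i, (i < n)%N & S (g - i%:R)].
have wT n : well_ordered (T n).
  elim: n => [|n IH]; first by move=> D DT [x /DT[]].
  have wn : well_ordered [set g | S (g - n%:R)].
    move=> D DS [x Dx].
    have [] := wS [set g - n%:R | g in D]; [by move=> _ [y Dy <-]; apply: DS|by exists (x - n%:R), x|].
    move=> _ [y Dy <-] yP; exists y => // z Dz.
    by have := yP (z - n%:R); rewrite lerD2r; apply; exists z.
  apply: (well_ordered_sub _ (well_orderedU IH wn)) => g [j].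
  by rewrite ltnS leq_eqVlt => /predU1P[->|jn] Sj; [right|left; exists j].
(* If [g <= c] and [g - j] is in [S], then [m <= g - j], whence [j <= c - m]. *)
pose n := (Num.truncn (c - m)).+1.
have [||x [Cx xc] xP] := wT n [set g | C g /\ g <= c].
- move=> g [Cg gc]; have [j Sj] := CS g Cg; exists j => //.
  rewrite ltnS -[j](@natrK R) le_truncn // lerBrDr.
  by have := mP _ Sj; rewrite lerBrDr => /le_trans; rewrite addrC; apply.
- by exists c.
exists x => // y Cy; have [yc|/ltW cy] := leP y c; first exact: xP.
exact: le_trans xc cy.
Qed.

End RealSets.

Section HahnBasics.
Variables (R : realType) (G : set R) (A : zmodType).

Lemma hahn_of (f : R -> A) (S : set R) :
  supp f `<=` S -> S `<=` G -> well_ordered S -> exists b : hahn G A, f = b.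
Proof.
move=> fS SG wS.
have fP : f \in hahn_pred G (A := A).
  by apply/asboolP; split; [apply: subset_trans SG|apply: well_ordered_sub wS].
by exists (Hahn fP).
Qed.

Lemma hahnB (b c : hahn G A) g : (b - c) g = b g - c g.
Proof. by []. Qed.

Lemma hahn_supp (a : hahn G A) : supp a `<=` G.
Proof. by case: a => b /= /asboolP[]. Qed.

Lemma hahn_wo (a : hahn G A) : well_ordered (supp a).
Proof. by case: a => b /= /asboolP[]. Qed.

(** Carries move along a coset of the integers; this bounds how far down they can originate. *)
Definition zero_from (a : R -> A) g n := forall i, (n <= i)%N -> a (g - i%:R) = 0.

Lemma hahn_zero_from (a : hahn G A) g : exists n, zero_from a g n.
Proof.
have [S0|/nonemptyPn S0] := pselect (supp a !=set0); last first.
  exists 0%N => i _; apply: contrapT => /eqP h.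
  by have : supp a (g - i%:R) by []; rewrite S0.
have [m _ mP] := hahn_wo (a := a) (@subset_refl _ _) S0.
exists (Num.truncn (g - m)).+1 => i ni; apply: contrapT => /eqP /mP.
apply/negP; rewrite -ltNge ltrBlDr -ltrBlDl (lt_le_trans (truncnS_gt _)) //.
by rewrite ler_nat.
Qed.

End HahnBasics.

Section MinSupp.
Variables (R : realType) (G : set R) (A : zmodType).
Implicit Types b c : hahn G A.

Lemma hahn_ext b c : (forall g, b g = c g) -> b = c.
Proof. by move=> bc; apply/val_inj/funext. Qed.

Lemma min_suppP c : (c = 0 /\ min_supp c = +oo%E) \/
  exists g, [/\ G g, c g != 0, forall x, x < g -> c x = 0 & min_supp c = g%:E].
Proof.
have [S0|/nonemptyPn S0] := pselect (supp c !=set0); last first.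
  left; split; last by rewrite /min_supp S0 image_set0 ereal_inf0.
  apply: hahn_ext => g; apply: contrapT => /eqP h.
  by have : supp c g by []; rewrite S0.
have [g cg gP] := hahn_wo (@subset_refl _ _) S0.
right; exists g; split=> [||x|]; [exact: hahn_supp cg|exact: cg| |].
  by move=> xg; apply: contrapT => /eqP/gP; rewrite leNgt xg.
apply/eqP; rewrite eq_le; apply/andP; split.
  by apply: ereal_inf_lbound; exists g.
by apply: le_ereal_inf_tmp => _ [x cx <-]; rewrite lee_fin gP.
Qed.

(** Stated through vanishing on half-lines, to compare the standard series of a difference with the
    difference of standard series, which may be distinct. *)
Lemma min_supp_eq b c :
  (forall h, (forall g, g < h -> b g = 0) <-> (forall g, g < h -> c g = 0)) ->
  min_supp b = min_supp c.
Proof.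
have lt0 c' g h : g < h -> c' g != 0 -> ~ (forall x, x < h -> c' x = 0).
  by move=> gh /eqP cg /(_ g gh).
move=> h; have [[b0 ->]|[g [_ bg bP ->]]] := min_suppP b;
  have [[c0 ->]|[x [_ cx cP ->]]] := min_suppP c => //.
- by exfalso; apply: (lt0 c x (x + 1)) => //; [rewrite ltrDl|apply/h; rewrite b0].
- by exfalso; apply: (lt0 b g (g + 1)) => //; [rewrite ltrDl|apply/h; rewrite c0].
- have [xg|gx|-> //] := ltgtP x g; exfalso.
    by apply: (lt0 c x g) => //; apply/h.
  by apply: (lt0 b g x) => //; apply/h.
Qed.

End MinSupp.

(** Common abstraction of both fields as the set of series with coefficients in [J]. As [J] need not
    be closed under subtraction, [s x - s y] may leave the image of [s]. *)
Definition hahn_model (R : realType) (G : set R) (A : valuedGroup R)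
    (W : zmodType) (J : set W) (s : A -> hahn G W) :=
  [/\ injective s, forall x g, J (s x g),
      forall b : hahn G W, (forall g, J (b g)) -> exists x, s x = b &
      forall x y, vval (x - y) = min_supp (s x - s y)].

Lemma hahn_modelT (R : realType) (G : set R) (W : zmodType) :
  hahn_model (A := ValuedGroup (@min_supp R G W)) [set: W] id.
Proof. by split=> // b _; exists b. Qed.

(** * The ultrametric on Hahn series *)

Section HahnDistance.
Variables (R : realType) (eta : R) (eta_gt1 : 1 < eta) (G : set R) (W : zmodType).
Implicit Types b c : hahn G W.

Definition hahn_dist b c : R := exp_val eta (min_supp (b - c)).

Lemma exp_gt0 x : 0 < eta `^ (- x).
Proof. by rewrite powR_gt0 // (lt_trans ltr01). Qed.

Lemma exp_le x y : (eta `^ (- x) <= eta `^ (- y)) = (y <= x).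
Proof.
have eta0 : 0 < eta by apply: lt_trans eta_gt1.
rewrite /powR gt_eqF // ler_expR !mulNr lerN2 ler_pM2r //.
by rewrite ln_gt0.
Qed.

Lemma exp_lt x y : (eta `^ (- x) < eta `^ (- y)) = (y < x).
Proof. by rewrite !ltNge exp_le. Qed.

Lemma hahn_distP b c : (b = c /\ hahn_dist b c = 0) \/
  exists g, [/\ G g, b g <> c g, forall x, x < g -> b x = c x &
                hahn_dist b c = eta `^ (- g)].
Proof.
rewrite /hahn_dist; have [[bc ->]|[g [Gg bg bP ->]]] := min_suppP (b - c).
  by left; split=> //; apply/eqP; rewrite -subr_eq0 bc.
right; exists g; split=> // [bcg|x xg]; first by rewrite hahnB bcg subrr eqxx in bg.
by apply/eqP; rewrite -subr_eq0 -hahnB bP.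
Qed.

Lemma hahn_distxx b : hahn_dist b b = 0.
Proof. by have [[]|[g []]] := hahn_distP b b. Qed.

Lemma hahn_dist_ge0 b c : 0 <= hahn_dist b c.
Proof. by have [[_ ->]|[g [_ _ _ ->]]] := hahn_distP b c; rewrite // ltW ?exp_gt0. Qed.

(** Compared with the strict version below, only the coefficient at [h] is left free: it separates
    the open balls inside a closed one. *)
Lemma hahn_dist_le b c h :
  hahn_dist b c <= eta `^ (- h) <-> forall x, x < h -> b x = c x.
Proof.
have [[-> ->]|[g [_ bg bP ->]]] := hahn_distP b c.
  by split=> // _; rewrite ltW ?exp_gt0.
rewrite exp_le; split=> [hg x xh|bc]; first by apply: bP; apply: lt_le_trans hg.
by rewrite leNgt; apply/negP => /bc.
Qed.

Lemma hahn_dist_lt b c h :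
  hahn_dist b c < eta `^ (- h) <-> forall x, x <= h -> b x = c x.
Proof.
have [[-> ->]|[g [_ bg bP ->]]] := hahn_distP b c.
  by split=> // _; rewrite exp_gt0.
rewrite exp_lt; split=> [hg x xh|bc]; first by apply: bP; apply: le_lt_trans hg.
by rewrite ltNge; apply/negP => /bc.
Qed.

Lemma hahn_dist_range b c : exp_range eta G (hahn_dist b c).
Proof.
have [[_ ->]|[g [Gg _ _ ->]]] := hahn_distP b c; first by left.
by right; exists g.
Qed.

Lemma hahn_dist_eq0 b c : hahn_dist b c = 0 -> b = c.
Proof.
have [[]//|[g [_ _ _ ->]] g0] := hahn_distP b c.
by have := exp_gt0 g; rewrite g0 ltxx.
Qed.

Lemma hahn_dist_sym b c : hahn_dist b c = hahn_dist c b.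
Proof.
have le b' c' : hahn_dist b' c' <= hahn_dist c' b'.
  have [[-> _]//|[g [_ _ cP ->]]] := hahn_distP c' b'.
  by apply/hahn_dist_le => x /cP.
by apply/eqP; rewrite eq_le !le.
Qed.

Lemma hahn_dist_ultra b c e :
  hahn_dist b e <= Num.max (hahn_dist b c) (hahn_dist c e).
Proof.
have [[_ ->]|[g [_ bg _ ->]]] := hahn_distP b e; first by rewrite le_max hahn_dist_ge0.
rewrite leNgt gt_max; apply/negP => /andP[/hahn_dist_lt bc /hahn_dist_lt ce].
by apply: bg; rewrite bc // ce.
Qed.

End HahnDistance.

(** * Subgroups of the reals: cyclic, or with arbitrarily small positive elements *)

Section DiscreteSubgroup.
Variables (R : realType) (G : set R).
Hypothesis G_subgroup : real_subgroup G.

Lemma real_subgroupMz x (m : int) : G x -> G (m%:~R * x).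
Proof.
case: G_subgroup => G0 GB Gx.
have GN y : G y -> G (- y) by move=> Gy; rewrite -sub0r; apply: GB.
have Gn (n : nat) : G (n%:R * x).
  elim: n => [|n IH]; first by rewrite mul0r.
  by rewrite -natr1 mulrDl mul1r; apply: real_subgroupD.
case: m => n; first exact: Gn.
by rewrite NegzE rmorphN mulNr; apply/GN/Gn.
Qed.

(** Division with remainder by [d]: the remainder lies in [G] and in [[0, d)], hence is 0. *)
Lemma least_order_isomorphic d : G d -> 0 < d ->
  (forall g, G g -> 0 < g -> d <= g) -> order_isomorphic_int G.
Proof.
move=> Gd d0 dP; exists (fun m => m%:~R * d); split=> [m n|].
  by rewrite ler_pM2r // ler_int.
apply/seteqP; split=> [_ [m _ <-]|g Gg]; first exact: real_subgroupMz.
exists (Num.floor (g / d)) => //; apply/esym/eqP; rewrite -subr_eq0.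
set m := Num.floor _; have md : m%:~R * d <= g by rewrite -ler_pdivlMr // floor_le.
have Gr : G (g - m%:~R * d) by case: G_subgroup => _; apply=> //; apply: real_subgroupMz.
have : 0 <= g - m%:~R * d by rewrite subr_ge0.
rewrite le_eqVlt => /predU1P[<- //|/(dP _ Gr)].
rewrite lerBrDl -[X in _ + X]mul1r -mulrDl -ler_pdivlMr // => gd.
have := floorD1_gt (g / d); rewrite -/m rmorphD /= => /(le_lt_trans gd).
by rewrite ltxx.
Qed.

Lemma order_isomorphic_int_or_dense :
  order_isomorphic_int G \/ forall g, G g -> 0 < g -> exists2 h, G h & 0 < h < g.
Proof.
have [[d [Gd d0 dP]]|no] :=
    pselect (exists d, [/\ G d, 0 < d & forall g, G g -> 0 < g -> d <= g]).
  by left; apply: least_order_isomorphic dP.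
right=> g Gg g0; apply: contrapT => noh; apply: no; exists g; split=> // h Gh h0.
by rewrite leNgt; apply/negP => hg; apply: noh; exists h; rewrite ?h0.
Qed.

End DiscreteSubgroup.

(** * The equivalence for series with countably many coefficients *)

Section Model.
Variables (R : realType) (eta : R) (eta_gt1 : 1 < eta) (G : set R).
Hypotheses (G_subgroup : real_subgroup G) (Z_sub_G : forall n : int, G (n%:~R)).
Variables (A : valuedGroup R) (W : zmodType) (e : nat -> W) (s : A -> hahn G W).
Hypotheses (e_inj : injective e) (sP : hahn_model (range e) s).
Local Notation D := (exp_range eta G).

Lemma val_distE x y : val_dist eta x y = hahn_dist eta (s x) (s y).
Proof. by case: sP => _ _ _ sE; rewrite /val_dist sE. Qed.

Lemma val_distP : distance (@val_dist R eta A).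
Proof.
have [s_inj _ _ _] := sP.
apply: ultra_distance => [x y|x|x y|x y|x y z]; rewrite !val_distE.
- exact: hahn_dist_ge0.
- exact: hahn_distxx.
- by move=> /(hahn_dist_eq0 eta_gt1)/s_inj.
- exact: hahn_dist_sym.
- exact: hahn_dist_ultra.
Qed.

Local Notation X := (distance_space val_distP).

Let mdistE (x y : X) : mdist x y = hahn_dist eta (s x) (s y).
Proof. exact: val_distE. Qed.

Lemma hahn_ultrametric : ultrametric X.
Proof. by move=> x y z; rewrite !mdistE; apply: hahn_dist_ultra. Qed.

Lemma hahn_valued_in : valued_in D X.
Proof. by move=> x y; rewrite mdistE; apply: hahn_dist_range. Qed.

Lemma exp_range_gt0 r : D r -> 0 < r -> exists2 g, G g & r = eta `^ (- g).
Proof. by move=> [->|[g Gg <-] _]; [rewrite ltxx|exists g]. Qed.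

(** The centres are obtained from [x] by replacing its coefficient at [g] by each [e i]; these are
    all the possible coefficients. *)
Lemma hahn_residual : residual D X.
Proof.
have [s_inj sJ s_surj _] := sP.
move=> x r /exp_range_gt0 rP /rP[g Gg ->].
have upd i : exists y : X, forall z, s y z = if z == g then e i else s x z.
  have [|||b bE] := @hahn_of R G W (fun z => if z == g then e i else s x z)
    (supp (s x) `|` [set g]).
  - by move=> z; rewrite /supp /=; case: (eqVneq z g) => [-> _|_ xz]; [right|left].
  - by move=> z [/hahn_supp|/= ->].
  - apply: well_orderedU; first exact: hahn_wo.
    move=> C Cg [z Cz]; exists z => // y Cy.
    by rewrite (Cg z Cz : z = g) (Cg y Cy : y = g).
  have [|y yb] := s_surj b; last by exists y => z; rewrite yb -bE.
  by move=> z; rewrite -bE; case: ifP => _ //; exists i.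
have [rho rhoP] := choice upd; exists rho; split=> [i|i j ij|y].
- by rewrite mdistE; apply/(hahn_dist_le eta_gt1) => z zg; rewrite rhoP lt_eqF.
- rewrite mdistE; apply/eqP; rewrite eq_le; apply/andP; split.
    by apply/(hahn_dist_le eta_gt1) => z zg; rewrite !rhoP lt_eqF.
  rewrite leNgt; apply/negP => /(hahn_dist_lt eta_gt1)/(_ g (lexx g)).
  by rewrite !rhoP eqxx => /e_inj ij'; rewrite ij' eqxx in ij.
rewrite mdistE => /(hahn_dist_le eta_gt1) xy; have [i _ iE] := sJ y g.
exists i; rewrite mdistE; apply/(hahn_dist_lt eta_gt1) => z.
by rewrite rhoP le_eqVlt => /predU1P[->|zg]; [rewrite eqxx|rewrite lt_eqF // xy].
Qed.

(* The limit of a spherical sequence reads each coefficient off a term that is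
   already accurate there, and vanishes above all the radii. *)
Lemma hahn_spherical : seq_spherical D X.
Proof.
have [s_inj sJ s_surj _] := sP.
move=> r x Dr r_dec xr.
have r0 n : 0 < r n by have /andP[r1 r2] := r_dec n; exact: lt_trans r2.
have [g gP] : exists g : nat -> R, forall n, G (g n) /\ r n = eta `^ (- g n).
  suff /choice[g gP] : forall n, exists g, G g /\ r n = eta `^ (- g) by exists g.
  by move=> n; have [g Gg rE] := exp_range_gt0 (Dr n) (r0 n); exists g.
have g_lt n : g n < g n.+1.
  by have /andP[_] := r_dec n; rewrite (gP n).2 (gP n.+1).2 exp_lt.
have g_mono m n : (m <= n)%N -> g m <= g n.
  elim: n => [|n IH]; first by rewrite leqn0 => /eqP ->.
  by rewrite leq_eqVlt => /predU1P[->//|/IH/le_trans]; apply; apply: ltW.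
have xx m n z : (m <= n)%N -> z < g m -> s (x n) z = s (x m) z.
  move=> mn zm; elim: n mn => [|n IH]; first by rewrite leqn0 => /eqP ->.
  rewrite leq_eqVlt ltnS => /predU1P[->//|mn]; rewrite -IH //.
  have := xr n; rewrite mdistE (gP n).2 => /(hahn_dist_le eta_gt1) -> //.
  exact: lt_le_trans zm (g_mono _ _ mn).
(* Zero is a coefficient of any series, far enough below its support. *)
have J0 : range e 0 by have [n /(_ n (leqnn n)) <-] := hahn_zero_from (s (x 0)) 0.
have [f fP] : exists f : R -> W, forall z,
    (forall n, z < g n -> f z = s (x n) z) /\ (f z != 0 -> exists n, z < g n).
  pose P z w := (forall n, z < g n -> w = s (x n) z) /\ (w != 0 -> exists n, z < g n).
  suff /choice[f fP] : forall z, exists w, P z w by exists f.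
  move=> z; have [[n zn]|no] := pselect (exists n, z < g n); last first.
    by exists 0; split=> [n zn|/eqP//]; exfalso; apply: no; exists n.
  exists (s (x n) z); split=> [m zm|_]; last by exists n.
  by have [mn|/ltnW nm] := leqP m n; [apply: xx|apply/esym/xx].
have fJ z : range e (f z).
  have [-> //|/(fP z).2[n zn]] := eqVneq (f z) 0.
  by rewrite ((fP z).1 n zn); apply: sJ.
have [|||b bE] := @hahn_of R G W f (supp f).
- exact: subset_refl.
- move=> z fz; have [n zn] := (fP z).2 fz.
  by apply: (@hahn_supp _ _ _ (s (x n))); rewrite /supp /= -((fP z).1 n zn).
(* Below [g n] the limit agrees with [s (x n)], so the part of [C] there has a least element. *)
- move=> C Cf [c Cc]; have [n cn] := (fP c).2 (Cf c Cc).
  have [||m [Cm mn] mP] := hahn_wo (a := s (x n)) (C := [set z | C z /\ z < g n]).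
  + by move=> z [Cz zn]; rewrite /supp /= -((fP z).1 n zn); apply: Cf.
  + by exists c.
  exists m => // y Cy; have [yn|ny] := ltP y (g n); first exact: mP.
  exact: ltW (lt_le_trans mn ny).
have [|y yb] := s_surj b; first by move=> z; rewrite -bE.
exists y => n; rewrite mdistE (gP n).2; apply/(hahn_dist_le eta_gt1) => z zn.
by rewrite yb -bE; apply: (fP z).1.
Qed.

Lemma isometric_spherical (V : metricType R) (f : X -> V) : bijective f ->
  isometric_embedding f -> seq_spherical D V.
Proof.
move=> [g fK gK] f_iso r x Dr r_dec xr.
have [|y yP] := hahn_spherical (x := g \o x) Dr r_dec.
  by move=> n; rewrite /= -f_iso !gK.
by exists (f y) => n; rewrite -[x n]gK f_iso; apply: yP.
Qed.

Lemma exp_small c : 0 < c -> exists n : int, eta `^ (- n%:~R) < c.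
Proof.
move=> c0; have l0 : 0 < ln eta by rewrite ln_gt0.
(* The condition on [n] amounts to [n > - ln c / ln eta]. *)
exists (Num.floor (- ln c / ln eta) + 1).
rewrite -[X in _ < X]lnK ?posrE // /powR gt_eqF ?(lt_trans ltr01) // ltr_expR.
by rewrite mulNr ltrNl -ltr_pdivrMr // floorD1_gt.
Qed.

Lemma hahn_urysohn_iff : order_isomorphic_int G <->
  exists V : metricType R, urysohn_universal D V /\
    isometric_to (@val_dist R eta A) V.
Proof.
split=> [[f [f_mono fG]]|[V [uV [f [f_bij f_iso]]]]].
  exists X; split; last by exists id; split=> //; exists id.
  have DE : D = [set 0] `|` range (fun m => eta `^ (- f m)).
    by rewrite /exp_range -fG image_comp.
  left; split.
    rewrite DE -bigcup2E; apply: bigcup_countable => // -[|[|n]] _ /=.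
    - exact: countable1.
    - exact: sub_countable (card_image_le _ _) (countableP _).
    - exact: countable0.
  apply: (discrete_urysohn DE) => [m|m n|c c0|||||].
  - exact: exp_gt0.
  - by rewrite exp_lt // !ltNge f_mono.
  - have [n nc] := exp_small c0; have := Z_sub_G n; rewrite -fG => -[m _ mn].
    by exists m; rewrite mn.
  - by exists (0 : A).
  - exact: hahn_ultrametric.
  - exact: hahn_valued_in.
  - exact: hahn_residual.
  - exact: hahn_spherical.
have [//|dense_G] := order_isomorphic_int_or_dense G_subgroup; exfalso.
have [h hP] : exists h : R -> R, forall g, G g -> 0 < g -> G (h g) /\ 0 < h g < g.
  pose P g x := G g -> 0 < g -> G x /\ 0 < x < g.
  suff /choice[h hP] : forall g, exists x, P g x by exists h.
  move=> g; have [[Gg g0]|no] := pselect (G g /\ 0 < g).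
    by have [x Gx xg] := dense_G g Gg g0; exists x.
  by exists 0 => Gg g0; case: no.
pose g n := iter n h 1.
have gP n : G (g n) /\ 0 < g n.
  elim: n => [|n [Gn n0]]; first by split; [exact: (Z_sub_G 1)|exact: ltr01].
  by have [? /andP[]] := hP _ Gn n0.
have GN x : G x -> G (- x) by case: G_subgroup => G0 GB Gx; rewrite -sub0r; apply: GB.
(* The [g n] decrease strictly and stay positive, so the radii [eta ^ (g n)] decrease strictly and
   stay above [eta ^ 0]. *)
apply: (not_urysohn_universal (r := fun n => eta `^ (- - g n)) (c := eta `^ (- 0))) uV.
- by left.
- exact: (isometric_spherical (f := f)).
- by move=> n; right; exists (- g n) => //; apply/GN/(gP n).1.
- move=> n; rewrite exp_lt // ltrN2.
  by have [Gn n0] := gP n; have [_ /andP[]] := hP _ Gn n0.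
- exact: exp_gt0.
- by move=> n; rewrite exp_lt // oppr_lt0 (gP n).2.
Qed.

End Model.

(** * Witt vectors and p-adic Hahn fields *)

Section WittMod.
Variables (p : nat) (pp : prime p).

(** Multiples of one as raw sequences over any ring, so that ghost components can be compared over
    [wpoly] and the result transported. *)
Definition wnat (B : comNzRingType) n : nat -> B :=
  iter n (wadd p (@wone B)) (@wzero B).

Lemma wnat_morph (B C : comNzRingType) (h : {rmorphism B -> C}) n :
  h \o @wnat B n = @wnat C n.
Proof.
elim: n => [|n IH]; first exact: wzero_morph.
by rewrite /wnat !iterS wadd_morph wone_morph -/(wnat _ _) IH.
Qed.

Lemma ghost_wnat (B : comNzRingType) m n : ghost p m (@wnat B n) = n%:R.
Proof.
elim: n => [|n IH]; first exact: ghost_wzero.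
by rewrite /wnat iterS ghost_wadd // ghost_wone // -/(wnat _ _) IH mulrS.
Qed.

(* Both sides have congruent ghost components over the integers: p in degree n > 0,
   and p against 0 in degree 0. *)
Lemma wnat_prime (k : comNzRingType) : p \in [pchar k] ->
  @wnat k p = wshift (@wone k).
Proof.
(* Both vectors come from [wpoly] through any morphism; this one sends every variable to 0. *)
move=> pk; pose h : {rmorphism wpoly -> k} := weval (wsubst [::]).
rewrite -(wnat_morph h) -(wone_morph h) -wshift_morph.
apply/funext => n; apply: (cong_pchar pk); move: n.
apply: (ghost_cong (prime_gt0 pp) wpoly_mulrIn) => -[|n].
  by rewrite ghost_wnat ghost_wshift0; apply: cong0.
by rewrite ghost_wnat ghost_wshiftS // ghost_wone //; apply: cong_refl.
Qed.

End WittMod.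

Section WittResidue.
Variables (p : nat) (k : fieldType) (pk : p \in [pchar k]).
Local Notation W := (witt pk).
Let pp : prime p := pcharf_prime pk.

Definition witt_res (w : W) : k := wcomp w 0.

Lemma witt_resD (x y : W) : witt_res (x + y) = witt_res x + witt_res y.
Proof. exact: wadd_0. Qed.

Lemma witt_resM (x y : W) : witt_res (x * y) = witt_res x * witt_res y.
Proof. exact: wmul_0. Qed.

Lemma witt_res0 : witt_res 0 = 0. Proof. by []. Qed.

Lemma witt_resB (x y : W) : witt_res (x - y) = witt_res x - witt_res y.
Proof. by apply/(canRL (addrK _)); rewrite -witt_resD subrK. Qed.

Lemma witt_natE n : n%:R = Witt pk (wnat p k n).
Proof. by elim: n => [|n IH] //; rewrite mulrS IH. Qed.

Lemma witt_prime : p%:R = Witt pk (wshift (wone k)).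
Proof. by rewrite witt_natE wnat_prime. Qed.

Lemma witt_prime_neq0 : p%:R != 0 :> W.
Proof.
rewrite witt_prime; apply/eqP => /(congr1 (fun w => wcomp w 1%N)) /=.
by move/eqP; rewrite /wone /wzero oner_eq0.
Qed.

Lemma witt_res_primeM (x : W) : witt_res (p%:R * x) = 0.
Proof. by rewrite witt_resM witt_prime /= mul0r. Qed.

(** Multiplication by p is the shift of the Frobenius, so dividing by p means shifting back and
    taking p-th roots of the components. *)
Lemma witt_res_eq0 (x : W) : perfect_field k p -> witt_res x = 0 ->
  exists y, x = p%:R * y.
Proof.
move=> [p0|perf] x0; first by have := prime_gt0 pp; rewrite lt0n => /eqP.
have [r rE] : exists r : k -> k, forall u, r u ^+ p = u.
  by exists (fun u => xget 0 [set v | v ^+ p = u]) => u; case: xgetP => // /(_ _) h;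
     have [v /h] := perf u.
exists (Witt pk (fun i => r (wcomp x i.+1))).
rewrite witt_prime; case: x x0 => x x0; congr Witt => /=.
rewrite (wshift_mul pp pk) (wmul1 pp).
by apply/funext => -[|i] //=; rewrite /wfrob rE.
Qed.

End WittResidue.

(** * Carries in base p with digits in J *)

Section Carry.
Variables (R : realType) (G : set R).
Variables (p : nat) (k : fieldType) (pk : p \in [pchar k]).
Hypothesis perf : perfect_field k p.
Local Notation W := (witt pk).
Variables (J : set W) (J_reps : complete_reps J).

Definition witt_lift (u : k) : W := xget 0 [set w | J w /\ witt_res w = u].

Lemma witt_liftP u : J (witt_lift u) /\ witt_res (witt_lift u) = u.
Proof.
rewrite /witt_lift; case: xgetP => // h.
have [_ [_ _ /(_ u I)]] := J_reps => -[w Jw wu].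
by case: (h w).
Qed.

Lemma witt_reps_inj v w : J v -> J w -> witt_res v = witt_res w -> v = w.
Proof. by have [_ [_ inj _]] := J_reps => Jv Jw; apply: inj; rewrite inE. Qed.

Lemma witt_lift0 : witt_lift 0 = 0.
Proof.
have [J0 _] := J_reps; have [Jl l0] := witt_liftP 0.
by apply: witt_reps_inj.
Qed.

(** The carry left once the digit of [w] in [J] is removed. *)
Definition witt_quo (w : W) : W :=
  xget 0 [set y | w - witt_lift (witt_res w) = p%:R * y].

Lemma witt_quoE w : p%:R * witt_quo w = w - witt_lift (witt_res w).
Proof.
rewrite /witt_quo; case: xgetP => // h; exfalso.
have [|y /h] // := @witt_res_eq0 p k pk (w - witt_lift (witt_res w)) perf.
by rewrite witt_resB (witt_liftP _).2 subrr.
Qed.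

Lemma witt_quo0 : witt_quo 0 = 0.
Proof.
have /eqP := witt_quoE 0; rewrite witt_res0 witt_lift0 subr0 mulf_eq0.
by rewrite (negbTE (witt_prime_neq0 pk)) => /eqP.
Qed.

(** The carry out of [g] when only the [n] positions ending at [g] are taken into account. *)
Fixpoint carry_iter (a : R -> W) n g : W :=
  if n is m.+1 then witt_quo (a g + carry_iter a m (g - 1)) else 0.

Lemma carry_iter_stable a n m g :
  zero_from a g n -> (n <= m)%N -> carry_iter a m g = carry_iter a n g.
Proof.
elim: n m g => [|n IH] m g h nm.
  elim: m g h {nm} => //= m IHm g h.
  rewrite IHm => [|i _]; last by rewrite subr1Bn; apply: h.
  by have := h 0%N; rewrite subr0 addr0 => -> //; rewrite witt_quo0.
case: m nm => [//|m nm]; rewrite /carry_iter -/carry_iter.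
by rewrite (IH m) // => i ni; rewrite subr1Bn; apply: h.
Qed.

Variable a : hahn G W.

Lemma carry_exists : exists D : R -> W,
  (forall g, p%:R * D g =
     a g + D (g - 1) - witt_lift (witt_res (a g + D (g - 1)))) /\
  (forall g, zero_from a g 0 -> D g = 0).
Proof.
have [N NP] := choice (hahn_zero_from a).
exists (fun g => carry_iter a (N g) g); split=> g; last first.
  by move=> /carry_iter_stable ->.
rewrite -witt_quoE; congr (_ * _).
(* A common depth is used: enough for [g], and one more than enough for [g - 1]. *)
rewrite -(carry_iter_stable (NP g) (leq_maxl _ (N (g - 1)).+1)).
have : (N (g - 1)%R < maxn (N g) (N (g - 1)%R).+1)%N by rewrite leq_maxr.
case: (maxn _ _) => [//|m nm]; rewrite /carry_iter -/carry_iter.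
by rewrite (carry_iter_stable (NP (g - 1))).
Qed.

End Carry.

(** * Null series and divisibility by powers of p *)

Section PadicNull.
Variables (R : realType) (G : set R).
Variables (p : nat) (k : fieldType) (pk : p \in [pchar k]).
Local Notation W := (witt pk).
Local Notation FrW := {fraction W}.
Implicit Type c : hahn G W.

(** The terms below [g - M] vanish, and factoring out [p ^- M] leaves a sum of Witt vectors. *)
Lemma padic_partial_sum c g M d n : zero_from c g M.+1 ->
  \sum_(i < d + M + n) (tofrac (c (g + (i%:Z - (d + M)%N%:Z)%:~R)) : FrW) *
     p%:R ^ (i%:Z - (d + M)%N%:Z) =
  p%:R ^- M * tofrac (\sum_(j < M + n) c (g - M%:R + j%:R) * p%:R ^+ j).
Proof.
move=> cM; have pF : (p%:R : FrW) != 0.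
  by rewrite -(rmorph_nat (@FracField.tofrac W)) tofrac_eq0 witt_prime_neq0.
rewrite -addnA big_split_ord big1 => [|i _]; last first.
  rewrite (_ : c _ = 0) ?tofrac0 ?mul0r //.
  rewrite -opprB rmorphN subzn /=; last exact/ltnW/ltn_addr.
  by apply: cM; rewrite ltn_subRL ltn_add2r.
rewrite [LHS]add0r rmorph_sum mulr_sumr; apply: eq_bigr => j _ /=.
rewrite !PoszD /= opprD addrACA subrr add0r rmorphM rmorphXn rmorph_nat mulrCA; congr (_ * _).
  by rewrite rmorphB /= addrA addrAC.
by rewrite expfzDr // mulrC exprnN.
Qed.

Lemma padic_null_of c :
  (forall g, G g -> exists M, zero_from c g M.+1 /\ forall e, exists w,
     \sum_(j < e) c (g - M%:R + j%:R) * p%:R ^+ j = p%:R ^+ e * w) ->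
  c \in @padic_null R G p k pk.
Proof.
move=> h; apply/asboolP => g Gg e; have [M [cM cE]] := h g Gg.
have pF : (p%:R : FrW) != 0.
  by rewrite -(rmorph_nat (@FracField.tofrac W)) tofrac_eq0 witt_prime_neq0.
(* Past [M] all low terms are included; the sum is then a multiple of [p ^ n], hence of [p ^ e]. *)
exists (maxn M e) => m n; rewrite !geq_max => /andP[Mm em] /andP[Mn en].
have [w wE] := cE (M + n)%N; exists (p%:R ^+ (n - e) * w).
rewrite -(subnK Mm) (padic_partial_sum _ _ cM) wE exprD -mulrA.
rewrite [LHS]mulrC rmorphM rmorphXn rmorph_nat mulrC mulKf ?expf_neq0 //.
by rewrite !rmorphM !rmorphXn !rmorph_nat mulrA -exprD subnKC.
Qed.

Lemma padic_null_dvd c g : c \in @padic_null R G p k pk -> G g ->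
  zero_from c g 1 -> exists w, c g = p%:R * w.
Proof.
(* Precision 1 suffices, and [N.+1] terms from [g] upwards ensure that the term at [g] occurs. *)
move=> /asboolP/(_ g) h Gg cg; have [N /(_ N N.+1)] := h Gg 1%N.
case=> // w; have := padic_partial_sum N N.+1 cg; rewrite addn0 => ->.
rewrite expr0 invr1 mul1r expr1 -(rmorph_nat (@FracField.tofrac W)) -rmorphM.
move=> /eqP; rewrite tofrac_eq => /eqP; rewrite big_ord_recl /= !mulr0n subr0 addr0.
rewrite expr0 mulr1 => /(canRL (addrK _)) ->.
exists (w - \sum_(i < N) c (g + (lift ord0 i)%:R) * p%:R ^+ i).
rewrite mulrBr mulr_sumr; congr (_ - _); apply: eq_bigr => i _.
by rewrite mulrCA -exprS.
Qed.

End PadicNull.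

(** * Existence and uniqueness of standard series *)

Section PadicStd.
Variables (R : realType) (G : set R).
Variables (p : nat) (k : fieldType) (pk : p \in [pchar k]).
Hypothesis perf : perfect_field k p.
Local Notation W := (witt pk).
Variables (J : set W) (J_reps : complete_reps J).
Hypotheses (G_subgroup : real_subgroup G) (Z_sub_G : forall n : int, G (n%:~R)).

(* If D g is the carry out of position g, then a g - b g = p D g - D (g - 1), so
   that the partial sums of a - b telescope. *)
Lemma std_exists (a : hahn G W) : exists b : hahn G W,
  a - b \in @padic_null R G p k pk /\ forall g, J (b g).
Proof.
have [D [DE D0]] := carry_exists perf J_reps a.
(* The digit at [g] represents the residue of the coefficient plus the incoming carry. *)
pose f g := witt_lift J (witt_res (a g + D (g - 1))).
have f0 g : zero_from a g 0 -> f g = 0.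
  move=> ag; rewrite /f (D0 (g - 1)); last first.
    by move=> i _; rewrite subr1Bn; apply: ag.
  by have := ag 0%N isT; rewrite subr0 addr0 => ->; apply: witt_lift0.
have [|||b bE] := @hahn_of R G _ f (shift_supp (supp a)).
- move=> g fg; apply: contrapT => h; move/eqP: fg; apply; apply: f0 => i _.
  by apply: contrapT => /eqP ai; apply: h; exists i.
- move=> g [i /hahn_supp /(real_subgroupDn G_subgroup Z_sub_G i)].
  by rewrite subrK.
- apply: well_ordered_shift; exact: hahn_wo.
exists b; split; last first.
  by move=> g; rewrite -bE; apply: (witt_liftP J_reps _).1.
apply: padic_null_of => g Gg; have [M aM] := hahn_zero_from a g.
have aM0 i : (M <= i)%N -> zero_from a (g - i%:R) 0.
  by move=> Mi j _; rewrite -addrA -opprD -natrD; apply/aM/leq_trans/leq_addr.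
exists M; split=> [i Mi|e].
  by rewrite hahnB -bE f0 ?subr0; [apply/aM/ltnW|apply/aM0/ltnW].
have cE h : (a - b) h = p%:R * D h - D (h - 1).
  by rewrite hahnB -bE DE addrAC addrK.
(* The sum of the first [e] terms is [p ^ e] times the carry out of the last of them; for [e = 0]
   this carry is 0. *)
exists (D (g - M%:R + e%:R - 1)); elim: e => [|e IH].
  have -> : g - M%:R + 0%:R - 1 = g - M.+1%:R by rewrite addr0 -addrA -opprD natr1.
  by rewrite big_ord0 D0 ?mulr0 //; apply: aM0.
rewrite big_ord_recr [LHS]addrC IH cE mulrBl [D (_ - 1) * _]mulrC subrK mulrAC -exprS.
by rewrite -natr1 addrA addrK.
Qed.

(** At the lowest exponent of the coset where [b - b' - c] is nonzero, nullity forces divisibility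
    by p. There [b] and [b'] have equal residues, hence are equal in [J]. The term [c] allows a
    comparison only up to [h]. *)
Lemma std_unique (b b' c : hahn G W) h :
  (forall g, J (b g)) -> (forall g, J (b' g)) ->
  b - b' - c \in @padic_null R G p k pk -> (forall g, g < h -> c g = 0) ->
  forall g, g < h -> b g = b' g.
Proof.
move=> Jb Jb' nul c0 g gh; apply: contrapT => bg.
pose e := b - b' - c.
have eE x : x < h -> e x = b x - b' x by move=> xh; rewrite !hahnB c0 ?subr0.
have [M eM] := hahn_zero_from e g.
have lo i : 0 <= i%:R :> R by [].
have hi i : g - i%:R < h by rewrite (le_lt_trans _ gh) // gerBl.
(* The largest [n] gives the lowest exponent [g - n], still below [h]. *)
have [||n bn nP] := @ex_maxnP (fun i => e (g - i%:R) != 0) M.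
- by exists 0%N; rewrite subr0 eE // subr_eq0; apply/eqP.
- by move=> i; apply: contraNT; rewrite -ltnNge => /ltnW/eM ->.
have Gg : G (g - n%:R) by exact: hahn_supp bn.
have [|w wE] := @padic_null_dvd _ _ _ _ _ e _ nul Gg.
  move=> i i0; rewrite -addrA -opprD -natrD; apply: contrapT => /eqP/nP.
  by rewrite -{2}[n]addn0 leq_add2l leqNgt i0.
move/eqP: bn; apply; rewrite eE //; apply/eqP; rewrite subr_eq0; apply/eqP.
apply: (witt_reps_inj J_reps) => //; apply/eqP; rewrite -subr_eq0.
by rewrite -witt_resB -eE // wE witt_res_primeM.
Qed.

End PadicStd.

(** * The p-adic Hahn field as a set of standard series *)

Section PadicModel.
Variables (R : realType) (G : set R).
Variables (p : nat) (k : fieldType) (pk : p \in [pchar k]).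
Hypothesis perf : perfect_field k p.
Variables (J : set (witt pk)) (J_reps : complete_reps J).
Hypotheses (G_subgroup : real_subgroup G) (Z_sub_G : forall n : int, G (n%:~R)).
Local Notation Q := (@padic_hahn R G p k pk).
Local Notation Pr := (\pi_Q%qT).

Lemma padic_hahn_model :
  hahn_model (A := ValuedGroup (@padic_val R G p k pk J)) J
    (fun x : Q => std_series J (repr x)).
Proof.
pose s (x : Q) := std_series J (repr x); rewrite -/s.
have sP (x : Q) : repr x - s x \in padic_null (pk := pk) /\ forall g, J (s x g).
  rewrite /s /std_series; case: xgetP => // no.
  by have [b bP] := std_exists perf J_reps G_subgroup Z_sub_G (repr x); case: (no b).
have valE (x : Q) : padic_val J x = min_supp (s x) by [].
clearbody s.
have PrE (a b : hahn G (witt pk)) : (a - b \in padic_null (pk := pk)) = (Pr a == Pr b).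
  by rewrite Quotient.idealrBE.
have PrB (a b : hahn G (witt pk)) : Pr (a - b) = Pr a - Pr b by exact: raddfB.
have Pr0 : Pr 0 = 0 by exact: raddf0.
have sK x : Pr (s x) = x.
  by rewrite -[RHS]reprK; apply/esym/eqP; rewrite -PrE (sP x).1.
have uniq (b b' c : hahn G (witt pk)) h : (forall g, J (b g)) -> (forall g, J (b' g)) ->
    Pr b - Pr b' = Pr c -> (forall g, g < h -> c g = 0) ->
    forall g, g < h -> b g = b' g.
  move=> Jb Jb' bc; apply: (std_unique J_reps) => //.
  by rewrite PrE PrB bc.
have J0 : J 0 by case: J_reps.
have Js x := (sP x).2.
split=> [|x|b Jb|x y]; [exact: can_inj sK|exact: Js| |].
  exists (Pr b); apply: hahn_ext => g.
  have e : Pr (s (Pr b)) - Pr b = Pr 0 by rewrite sK subrr Pr0.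
  by apply: (uniq _ _ _ (g + 1) (Js _) Jb e); [|rewrite ltrDl].
apply: etrans (valE _) _; apply: min_supp_eq => h; split=> xy g gh.
  have e : Pr (s x) - Pr (s y) = Pr (s (x - y)) by rewrite !sK.
  by rewrite hahnB (uniq _ _ _ _ (Js _) (Js _) e xy g gh) subrr.
(* Conversely, [s (x - y)] is compared with the zero series, which is standard because 0 is in
   [J]. *)
have e : Pr (s (x - y)) - Pr 0 = Pr (s x - s y).
  by rewrite PrB !sK Pr0 subr0.
have J00 x' : J ((0 : hahn G (witt pk)) x') by exact: J0.
exact: (uniq _ 0 _ _ (Js _) J00 e xy g gh).
Qed.
End PadicModel.

(** * Uniform treatment of the ordinary and p-adic fields *)

Lemma hahn_fieldP (R : realType) (G : set R) (q p : nat) (k : fieldType)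
    (J : forall pk : p \in [pchar k], set (witt pk)) (P : valuedGroup R -> Prop) :
  (q = p \/ p \in [pchar k]) -> P (ValuedGroup (@min_supp R G k)) ->
  (forall pk, P (ValuedGroup (@padic_val R G p k pk (J pk)))) ->
  P (hahn_field G q J).
Proof.
rewrite /hahn_field => qp Pk Ppk; case: eqP => // qp'.
have pk : p \in [pchar k] by case: qp.
(* Generalising the boolean and its reflection proof makes the dependent match destructible. *)
suff H b (r : reflect (p \in [pchar k]) b) :
    P (match r with
       | ReflectT pk => ValuedGroup (@padic_val R G p k pk (J pk))
       | ReflectF _ => ValuedGroup (@min_supp R G k)
       end) by exact: H.
by case: r.
Qed.

Theorem corollary4p7 (R : realType) (eta : R) (eta_gt1 : 1 < eta)
    (G : set R) (G_subgroup : real_subgroup G)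
    (Z_sub_G : forall n : int, G (n%:~R))
    (q p : nat) (q_0_or_prime : q = 0%N \/ prime q)
    (p_0_or_prime : p = 0%N \/ prime p)
    (qp : q = p \/ (q = 0%N /\ (0 < p)%N))
    (k : fieldType) (k_char : has_characteristic k p)
    (k_perfect : perfect_field k p)
    (k_card : ([set: k] #= [set: nat])%card)
    (J : forall pk : p \in [pchar k], set (witt pk))
    (J_reps : forall pk : p \in [pchar k], complete_reps (J pk)) :
  order_isomorphic_int G <->
  exists V : metricType R,
    urysohn_universal (exp_range eta G) V /\
    isometric_to (@val_dist R eta (@hahn_field R G q p k J)) V.
Proof.
have [e [e_inj e_surj]] : exists e : nat -> k, injective e /\ range e = [set: k].
  have /card_set_bijP[f [_ f_inj f_surj]] := k_card.
  pose e n := xget 0 [set x | f x = n].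
  have eK n : f (e n) = n.
    by rewrite /e; case: xgetP => // no; have [x _ /no] := f_surj n I.
  exists e; split; first exact: can_inj eK.
  by apply/seteqP; split=> // x _; exists (f x) => //; apply: f_inj; rewrite ?inE ?eK.
apply: (hahn_fieldP (P := fun A => _ <-> exists V : metricType R,
    urysohn_universal (exp_range eta G) V /\ isometric_to (@val_dist R eta A) V)).
- by case: qp => [|[_ p0]]; [left|right; case: k_char => // -[p00]; rewrite p00 in p0].
- apply: (hahn_urysohn_iff eta_gt1 G_subgroup Z_sub_G e_inj
    (A := ValuedGroup (@min_supp R G k)) (s := id)).
  by rewrite e_surj; apply: hahn_modelT.
move=> pk; apply: (hahn_urysohn_iff eta_gt1 G_subgroup Z_sub_G
  (A := ValuedGroup (@padic_val R G p k pk (J pk))) (e := fun n => witt_lift (J pk) (e n))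
  (s := fun x => std_series (J pk) (repr x))).
  move=> m n /(congr1 (@witt_res _ _ _)).
  by rewrite !(witt_liftP (J_reps pk) _).2 => /e_inj.
(* Lifting an enumeration of [k] enumerates [J], since residues determine the elements of [J]. *)
suff -> : range (fun n => witt_lift (J pk) (e n)) = J pk.
  exact: padic_hahn_model.
apply/seteqP; split=> [_ [n _ <-]|w Jw]; first exact: (witt_liftP (J_reps pk) _).1.
have : range e (witt_res w) by rewrite e_surj.
move=> [n _ en]; exists n => //; rewrite en.
have [Jl lE] := witt_liftP (J_reps pk) (witt_res w).
exact: (witt_reps_inj (J_reps pk)).
Qed.
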